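(* Let $n,m\geq 1$ be integers with $nm>2$. Then for every function $\psi:\mathbb{N}\to\mathbb{R}_{\geq 0}$ and every $\mathbf{y}\in\mathbb{R}^m$, \[ \bigl|\mathcal{A}^{\mathbf{y}}_{n,m}(\psi)\bigr| =\begin{cases} 0 & \text{if } \sum_{q=1}^\infty q^{n-1}\psi(q)^m<\infty,\\ 1 & \text{if } \sum_{q=1}^\infty q^{n-1}\psi(q)^m=\infty,\end{cases} \] where $|\cdot|$ denotes Lebesgue measure on $[0,1]^{nm}$. No monotonicity assumption is made on $\psi$.
   Context: For $\mathbf{q}=(q_1,\dots,q_n)\in\mathbb{Z}^n$ let $|\mathbf{q}|=\max_i|q_i|$. A point $\mathbf{x}\in[0,1]^{nm}$ is regarded as an $n\times m$ real matrix, and $\mathbf{q}\mathbf{x}\in\mathbb{R}^m$ denotes the product of the row vector $\mathbf{q}$ with $\mathbf{x}$. All balls are taken with respect to the maximum norm. $\mathcal{A}^{\mathbf{y}}_{n,m}(\psi)$ is the set of $\mathbf{x}\in[0,1]^{nm}$ such that there are infinitely many pairs $(\mathbf{p},\mathbf{q})\in\mathbb{Z}^m\times(\mathbb{Z}^n\setminus\{\mathbf 0\})$ with $\mathbf{q}\mathbf{x}+\mathbf{p}$ lying in the max-norm ball in $\mathbb{R}^m/\mathbb{Z}^m$ centred at $\mathbf{y}$ of radius $\psi(|\mathbf{q}|)$ (equivalently, $\max_j|(\mathbf{q}\mathbf{x}+\mathbf{p}-\mathbf{y})_j|<\psi(|\mathbf{q}|)$ for some $\mathbf p$, modulo $\mathbb{Z}^m$).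 *)

(* Defs.v *)
From HB Require Import structures.
From mathcomp Require Import all_boot all_order all_algebra.
From mathcomp Require Import all_classical all_reals all_analysis.
Set Implicit Arguments. Unset Strict Implicit. Unset Printing Implicit Defensive.
Import Order.TTheory GRing.Theory Num.Theory.
Local Open Scope classical_set_scope.
Local Open Scope ring_scope.

Section Defs.
Variable R : realType.

Definition supnormZ (n : nat) (q : 'rV[int]_n) : nat := \max_(i < n) `|q ord0 i|%N.

Definition good_pair (n m : nat) (psi : nat -> R) (y : 'rV[R]_m) (x : 'M[R]_(n, m))
  (pq : 'rV[int]_m * 'rV[int]_n) : Prop :=
  pq.2 != 0 /\
  forall j : 'I_m,
    `| (map_mx intr pq.2 *m x) ord0 j + (pq.1 ord0 j)%:~R - y ord0 j | < psi (supnormZ pq.2).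

Definition A_set (n m : nat) (psi : nat -> R) (y : 'rV[R]_m) : set 'M[R]_(n, m) :=
  [set x : 'M[R]_(n, m) | (forall i j, 0 <= x i j <= 1) /\ ~ finite_set (good_pair psi y x)].

Definition box (n m : nat) (a b : 'M[R]_(n, m)) : set 'M[R]_(n, m) :=
  [set x : 'M[R]_(n, m) | forall i j, a i j <= x i j <= b i j].

Definition box_vol (n m : nat) (a b : 'M[R]_(n, m)) : R :=
  \prod_(i < n) \prod_(j < m) Num.max 0 (b i j - a i j).

Definition lebesgue_outer (n m : nat) (A : set 'M[R]_(n, m)) : \bar R :=
  ereal_inf [set (\sum_(0 <= k <oo) (box_vol (c k).1 (c k).2)%:E)%E
            | c in [set c : nat -> 'M[R]_(n, m) * 'M[R]_(n, m)
                   | A `<=` \bigcup_k box (c k).1 (c k).2]].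

Definition KG_series (n m : nat) (psi : nat -> R) : \bar R :=
  (\sum_(1 <= q <oo) ((q%:R) ^+ (n - 1) * psi q ^+ m)%:E)%E.

End Defs.

(* Main.v *)
Require Import Defs.
From HB Require Import structures.
From mathcomp Require Import all_boot all_order all_algebra.
From mathcomp Require Import all_classical all_reals all_analysis.
From mathcomp Require Import measurable_realfun ring lra zify.
Import Order.TTheory GRing.Theory Num.Theory.
Local Open Scope classical_set_scope.
Local Open Scope ring_scope.
Set Implicit Arguments. Unset Strict Implicit. Unset Printing Implicit Defensive.

(** Write [A_q] for the set of [x] with [q x] within [psi |q|] of [y] modulo 1.

    Divergence.  It suffices to use the integer vectors [q] with [q_0 = k] and
    [0 <= q_i < k], and to replace [psi] by [d = min psi (1/2)].  Then
    [|A_q| = (2 d_q)^m], and [A_q], [A_q'] are independent if [q], [q'] are not parallel.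
    If they are parallel, with [k' <= k] and [g = gcd k k'], integrating out the
    first row of [x] gives [|A_q \cap A_q'| <= (2 d_q (2 d_q' + g / k))^m], hence
    [|A_q \cap A_q'| <= (1 + eps) |A_q| |A_q'| + C_eps |A_q| (g / k)^m].
    For given [k], [k'] at most [g^(n-1)] pairs are parallel, so the error terms
    belonging to [k] add up to at most
    [C_eps d_k^m k^(n-1) \sum_(k' <= k) (g / k)^(m + n - 1)].
    The inner sum is at most 2 as soon as [m + n >= 4], which is what [n m > 2]
    amounts to.  With [S = \sum |A_q|] the second moment is therefore at most
    [(1 + eps) S^2 + O_eps(S)]; the constant in front of [S^2] being arbitrarily close
    to 1, the limsup set has full measure without any zero-one law.

    Convergence is the Borel-Cantelli argument, carried out for explicit covers
    of the [A_q] by cells of a fine grid. *)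

(** * Periodic functions of one variable *)
Section OneDim.
Context {R : realType}.
Local Notation mu := (@lebesgue_measure R).
Implicit Types (f : R -> \bar R).

Definition nearZ (d : R) : set R := [set z | exists p : int, `|z + p%:~R| < d].

Lemma nearZ_bigcup d : nearZ d = \bigcup_(p : int) `](- p%:~R - d), (- p%:~R + d)[%classic.
Proof.
apply/seteqP; split=> z.
  by case=> p; rewrite ltr_norml => /andP[h1 h2]; exists p => //=; rewrite in_itv /=; apply/andP; split; lra.
by case=> p _ /=; rewrite in_itv /= => /andP[h1 h2]; exists p; rewrite ltr_norml; apply/andP; split; lra.
Qed.

Lemma measurable_nearZ d : measurable (nearZ d).
Proof.
by rewrite nearZ_bigcup; apply: countable_bigcupT_measurable => //; exact: countableP.
Qed.

Definition near_ind (d z : R) : R := \1_(nearZ d) z.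

Lemma indE d z : near_ind d z = `[< nearZ d z >]%:R.
Proof. by rewrite /near_ind indicE. Qed.

Lemma ind_ge0 d z : 0 <= near_ind d z.
Proof. by rewrite /near_ind indicE. Qed.

Lemma ind_le1 d z : near_ind d z <= 1.
Proof. by rewrite /near_ind indicE; case: (_ \in _). Qed.

Lemma measurable_ind d : measurable_fun setT (near_ind d).
Proof. exact: measurable_indic (measurable_nearZ d). Qed.

Lemma nearZ_intD d z (k : int) : nearZ d (z + k%:~R) = nearZ d z.
Proof.
apply/propext; split=> -[p hp].
  by exists (k + p); rewrite intrD addrA.
exists (p - k); rewrite intrB.
by rewrite -addrA [_ + (_ - _)]addrC subrK.
Qed.

Lemma nearZN d z : nearZ d (- z) = nearZ d z.
Proof.
apply/propext; split=> -[p hp]; exists (- p); rewrite intrN.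
  by rewrite -normrN opprB addrC.
by rewrite -opprD normrN.
Qed.

Lemma ind_intD d z (k : int) : near_ind d (z + k%:~R) = near_ind d z.
Proof. by rewrite !indE nearZ_intD. Qed.

Lemma ind_natD d z (k : nat) : near_ind d (z + k%:R) = near_ind d z.
Proof. by rewrite -(ind_intD d z k) pmulrn. Qed.

Lemma indN d z : near_ind d (- z) = near_ind d z.
Proof. by rewrite !indE nearZN. Qed.

(** Lebesgue measure is [a] times its push-forward under [t |-> a * t + b]: the two agree on
    half-open intervals, which determine it. *)
Lemma ge0_integral_affine (a b u v : R) f : 0 < a ->
  measurable_fun setT f -> (forall x, 0 <= f x)%E ->
  (\int[mu]_(t in `[u, v[) f t =
   a%:E * \int[mu]_(t in `[((u - b) / a)%R, ((v - b) / a)%R[) f (a * t + b)%R)%E.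
Proof.
move=> a0 mf f0.
pose phi : measurableTypeR R -> measurableTypeR R := fun t => a * t + b.
have mphi : measurable_fun setT phi.
  by apply: measurable_funD => //; exact: measurable_funM.
pose nu0 := mscale (NngNum (ltW a0)) (pushforward mu phi).
pose nu := nu0 mphi.
have eqnu A : measurable A -> mu A = nu A.
  apply: (@lebesgue_measure_unique R nu) => _ [[x1 x2] _ <-].
  transitivity (a%:E * mu (phi @^-1` `]x1, x2]%classic))%E; last by [].
  rewrite (_ : phi @^-1` _ = `](x1 - b) / a, (x2 - b) / a]%classic); last first.
    apply/seteqP; split => t /=; rewrite !in_itv /= /phi ltr_pdivrMr// ler_pdivlMr//;
    move=> /andP[h1 h2]; apply/andP; split; lra.
  rewrite !lebesgue_measure_itv/= !lte_fin ltr_pM2r ?invr_gt0// ltrD2r.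
  case: ifP => _; last by rewrite mule0.
  rewrite -!EFinB -EFinM; congr EFin; field.
  exact: lt0r_neq0.
rewrite (@eq_measure_integral _ _ _ _ nu); last by move=> A mA _; exact: eqnu.
rewrite ge0_integral_mscale//=; last exact: measurable_funS mf.
rewrite (ge0_integral_pushforward mphi)//; last first.
  exact: measurable_funS mf.
congr (_ * _)%E.
rewrite (_ : phi @^-1` _ = `[(u - b) / a, (v - b) / a[%classic)//.
apply/seteqP; split => t /=; rewrite !in_itv /= /phi ltr_pdivlMr// ler_pdivrMr//;
    move=> /andP[h1 h2]; apply/andP; split; lra.
Qed.

(** Half-open, so that consecutive intervals are disjoint and the integer translates tile the
    line. *)
Definition I01 f : \bar R := (\int[mu]_(t in `[0%R, 1%R[) f t)%E.

Lemma ge0_integral_itv_split (u v w : R) f : u <= v -> v <= w ->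
  measurable_fun setT f -> (forall x, 0 <= f x)%E ->
  (\int[mu]_(t in `[u, w[) f t = \int[mu]_(t in `[u, v[) f t + \int[mu]_(t in `[v, w[) f t)%E.
Proof.
move=> uv vw mf f0.
have e : `[u, w[%classic = `[u, v[%classic `|` `[v, w[%classic.
  by rewrite -itv_bndbnd_setU.
rewrite e ge0_integral_setU//; first exact: measurable_funS mf.
apply/disj_setPRL => t /=; rewrite !in_itv/= => /andP[vt _].
by rewrite ltNge vt andbF.
Qed.

Lemma periodic_int f : (forall t, f (t + 1) = f t) -> forall t (k : int), f (t + k%:~R) = f t.
Proof.
move=> f1; have fn t (k : nat) : f (t + k%:R) = f t.
  by elim: k => [|k IH]; rewrite ?addr0// -natr1 addrA f1.
by move=> t [k|k]; [exact: fn | rewrite NegzE mulrNz -(fn (_ - _) k.+1) subrK].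
Qed.

(** Only the fractional part [v] of [u] matters. The interval [[v, 1 + v[] is then cut at 1, and its
    right piece is moved back by one period. *)
Lemma I01_shift f (u : R) : measurable_fun setT f -> (forall x, 0 <= f x)%E ->
  (forall t, f (t + 1) = f t) -> I01 (fun t => f (t + u)) = I01 f.
Proof.
move=> mf f0 f1.
have aff (b v w : R) : (\int[mu]_(t in `[v, w[) f t =
    \int[mu]_(t in `[(v - b)%R, (w - b)%R[) f (t + b)%R)%E.
  rewrite (@ge0_integral_affine 1 b)// mul1e !divr1.
  by under eq_integral do rewrite mul1r.
pose v := u - (Num.floor u)%:~R.
have /andP[fl fu] := floor_itv u.
have v0 : 0 <= v by rewrite subr_ge0.
have v1 : v <= 1 by rewrite lerBlDr addrC ltW//; move: fu; rewrite intrD.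
transitivity (I01 (fun t => f (t + v))).
  congr I01; apply/funext => t.
  by rewrite -(periodic_int f1 (t + v) (Num.floor u)) -addrA subrK.
rewrite /I01 -[in LHS](subrr v) -[X in `[_, X[](addrK v) -aff.
rewrite (@ge0_integral_itv_split v 1)//; last by rewrite lerDl.
rewrite (@ge0_integral_itv_split 0 v 1)// addeC; congr (_ + _)%E.
rewrite (aff 1) subrr addrAC subrr add0r.
by under eq_integral do rewrite f1.
Qed.

(** The unit interval is cut into [a] equal pieces, each of which is rescaled to the whole. *)
Lemma I01_dilate f (a : nat) : (0 < a)%N -> measurable_fun setT f -> (forall x, 0 <= f x)%E ->
  (I01 f = (a%:R^-1)%:E * \sum_(p < a) I01 (fun t => f ((t + p%:R) / a%:R)%R))%E.
Proof.
move=> a0 mf f0; have aR : 0 < a%:R :> R by rewrite ltr0n.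
have step (p : nat) : (\int[mu]_(t in `[(p%:R / a%:R)%R, (p.+1%:R / a%:R)%R[) f t =
   (a%:R^-1)%:E * I01 (fun t => f ((t + p%:R) / a%:R)%R))%E.
  rewrite (@ge0_integral_affine a%:R^-1 (p%:R / a%:R))// ?invr_gt0//.
  rewrite subrr mul0r -mulrBl -natrB// subSnn mul1r divff ?invr_neq0 ?gt_eqF//.
  congr (_ * _)%E; apply: eq_integral => t _; congr (f _).
  by rewrite mulrDl [t * _]mulrC.
have H n : (\int[mu]_(t in `[0%R, (n%:R / a%:R)%R[) f t =
   \sum_(p < n) (a%:R^-1)%:E * I01 (fun t => f ((t + p%:R) / a%:R)%R))%E.
  elim: n => [|n IH].
    by rewrite mul0r set_itvco0 integral_set0 big_ord0.
  rewrite big_ord_recr/= -IH -step -ge0_integral_itv_split ?divr_ge0//.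
  by rewrite ler_pM2r ?invr_gt0// ler_nat.
have := H a; rewrite divff ?gt_eqF// => Ha; rewrite {1}/I01 Ha.
rewrite ge0_sume_distrr// => p _.
by apply: integral_ge0.
Qed.

Lemma measurable_ind_affine d (a b : R) : measurable_fun setT (fun t => near_ind d (a * t + b)).
Proof.
apply: measurableT_comp (measurable_ind d) _.
by apply: measurable_funD => //; exact: measurable_funM.
Qed.

Lemma I01_cst (r : R) : 0 <= r -> I01 (fun=> r%:E) = r%:E.
Proof.
move=> r0; rewrite /I01 integral_cst//= lebesgue_measure_itv/= lte_fin ltr01.
by rewrite oppr0 adde0 mule1.
Qed.

(** After a translation by 1/2, allowed by periodicity, the neighbourhood of the integers meets the
    unit interval in a single interval centred at 1/2. *)
Lemma I01_ind_shift d w : 0 <= d -> d <= 1/2 -> I01 (fun t => (near_ind d (t + w))%:E) = (2 * d)%:E.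
Proof.
move=> d0 d1; pose f t := (near_ind d t)%:E.
have mf : measurable_fun setT f.
  by apply/measurable_EFinP; exact: measurable_ind.
have f0 t : (0 <= f t)%E by rewrite lee_fin ind_ge0.
have f1 t : f (t + 1) = f t by rewrite /f (ind_natD d t 1).
rewrite (I01_shift w mf f0 f1) -(I01_shift (1/2) mf f0 f1).
transitivity (\int[mu]_(t in `[0%R, 1%R[) (\1_(`](1/2 - d)%R, (1/2 + d)%R[%classic : set R) t)%:E)%E; last first.
  rewrite integral_indic// setIidl.
    transitivity (lebesgue_measure (`](1/2 - d)%R, (1/2 + d)%R[%classic : set R)); first by [].
    rewrite lebesgue_measure_itv/= lte_fin; case: ltP => h.
      by rewrite -EFinB; congr EFin; lra.
    by congr EFin; lra.
  move=> t /=; rewrite !in_itv/= => /andP[h1 h2]; apply/andP; split; lra.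
apply: eq_integral => t; rewrite inE/= in_itv/= => /andP[t0 t1].
rewrite /f indE indicE; congr (_%:R%:E); congr nat_of_bool.
apply/idP/idP => [/asboolP[p]|].
  rewrite inE/= in_itv/= ltr_norml => /andP[h1 h2].
  (* For [t] in the unit interval, [|t + 1/2 + p| < d <= 1/2] leaves only [p = -1]. *)
  have h3 : (-2 < p)%R by rewrite -(ltr_int R); lra.
  have h4 : (p < 0)%R by rewrite -(ltr_int R); lra.
  have pE : p = -1 by lia.
  by move: h1 h2; rewrite pE => h1 h2; apply/andP; split; lra.
rewrite inE/= in_itv/= => /andP[h1 h2]; apply/asboolP; exists (-1).
by rewrite ltr_norml; apply/andP; split; lra.
Qed.

Lemma I01_ind_dilate (k : nat) d c : (0 < k)%N -> 0 <= d -> d <= 1/2 ->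
  I01 (fun t => (near_ind d (k%:R * t + c))%:E) = (2 * d)%:E.
Proof.
move=> k0 d0 d1; have kR : k%:R != 0 :> R by rewrite pnatr_eq0 -lt0n.
rewrite (I01_dilate k0); last 2 first.
- by apply/measurable_EFinP; exact: measurable_ind_affine.
- by move=> x; rewrite lee_fin ind_ge0.
under eq_bigr => p _.
  rewrite (_ : (fun t => _) = (fun t => (near_ind d (t + c))%:E)); last first.
    apply/funext => t; rewrite mulrC mulfVK// addrAC.
    by rewrite ind_natD.
  rewrite I01_ind_shift//.
  over.
rewrite sumEFin -EFinM sumr_const card_ord; congr EFin.
by rewrite -[(2 * d) *+ k]mulr_natl mulKf.
Qed.

(* Each grid point is replaced by its average over an interval of length [1 / e], at the
   price of thickening the neighbourhood by [1 / (2 e)]. *)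
Lemma sum_ind_grid (e : nat) d w : (0 < e)%N -> 0 <= d ->
  \sum_(l < e) near_ind d (l%:R / e%:R + w) <= 2 * d * e%:R + 1.
Proof.
move=> e0 d0; have eR : 0 < e%:R :> R by rewrite ltr0n.
pose d1 := d + 1 / (2 * e%:R).
have d1E : 2 * d1 * e%:R = 2 * d * e%:R + 1 by rewrite /d1; field; rewrite gt_eqF.
(* A thickened radius above 1/2 makes the bound exceed the number [e] of terms. *)
have [d1h|d1h] := leP d1 (1/2); last first.
  rewrite -d1E; apply: (@le_trans _ _ (\sum_(l < e) 1)).
    by apply: ler_sum => l _; exact: ind_le1.
  by rewrite sumr_const card_ord -[leLHS]mul1r ler_pM2r//; lra.
have d10 : 0 <= d1 by rewrite /d1 addr_ge0// divr_ge0// mulr_ge0.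
(* The shift by [1 / (2 e)] centres each averaging interval at its grid point. *)
have := I01_ind_shift (w - 1 / (2 * e%:R)) d10 d1h.
rewrite (I01_dilate e0); last 2 first.
- apply/measurable_EFinP.
  have := @measurable_ind_affine d1 1 (w - 1 / (2 * e%:R)).
  by under eq_fun do rewrite mul1r.
- by move=> x; rewrite lee_fin ind_ge0.
move=> /esym hE.
have : ((e%:R^-1)%:E * \sum_(l < e) I01 (fun=> (near_ind d (l%:R / e%:R + w))%:E) <= (2 * d1)%:E)%E.
  rewrite hE lee_pmul2l ?fin_numE// ?lte_fin ?invr_gt0//.
  apply: lee_sum => l _; apply: ge0_le_integral => //.
  - by move=> x _; rewrite lee_fin ind_ge0.
  - apply/measurable_EFinP; apply: measurable_funTS.
    apply: measurableT_comp (measurable_ind d1) _.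
    apply: measurable_funD => //; apply: measurable_funM => //.
    exact: measurable_funD.
  - move=> t /=; rewrite in_itv/= => /andP[t0 t1]; rewrite lee_fin !indE ler_nat.
    case: (asboolP (nearZ d _)) => // -[p hp].
    suff -> : `[< nearZ d1 ((t + l%:R) / e%:R + (w - 1 / (2 * e%:R))) >] by [].
    apply/asboolP; exists p.
    rewrite (_ : _ + _ + _ = (l%:R / e%:R + w + p%:~R) + (t - 1/2) / e%:R); last by field; rewrite gt_eqF.
    apply: (le_lt_trans (ler_normD _ _)); rewrite /d1; apply: ltr_leD => //.
    rewrite normrM [X in _ * X]ger0_norm ?invr_ge0// (_ : 1 / (2 * e%:R) = (1/2) / e%:R); last by field; rewrite gt_eqF.
    rewrite ler_pM2r ?invr_gt0// ler_norml; apply/andP; split; lra.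
under eq_bigr do rewrite I01_cst ?ind_ge0//.
rewrite sumEFin -EFinM lee_fin ler_pdivrMl// -d1E; lra.
Qed.

Lemma sum_ord_mul (g e : nat) (F : nat -> R) : (forall p, F (p + e)%N = F p) ->
  \sum_(p < g * e) F p = g%:R * \sum_(p < e) F p.
Proof.
move=> Fe; elim: g => [|g IH]; first by rewrite mul0n big_ord0 mul0r.
have Fk k p : F (p + k * e)%N = F p.
  by elim: k p => [|k IHk] p; rewrite ?addn0// mulSn addnA IHk Fe.
rewrite -natr1 mulrDl mul1r -IH -!(big_mkord xpredT) mulSn addnC.
rewrite (big_cat_nat _ (leq_addr _ _))//=; congr (_ + _).
rewrite -{1}[(g * e)%N]add0n big_addn addKn.
by apply: eq_bigr => p _; rewrite Fk.
Qed.

(** Write [a = g e] and [b = g e'] with [g] the gcd. Modulo 1 the points [b p / a = e' p / e] run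
    [g] times through the multiples of [1 / e], so the grid bound is used [g] times. *)
Lemma sum_ind_progression (a b : nat) d w : (0 < a)%N -> 0 <= d ->
  \sum_(p < a) near_ind d (b%:R * p%:R / a%:R + w) <= 2 * d * a%:R + (gcdn a b)%:R.
Proof.
move=> a0 d0; pose g := gcdn a b.
have g0 : (0 < g)%N by rewrite gcdn_gt0 a0.
have [e aE] : exists e, a = (g * e)%N.
  by exists (a %/ g)%N; rewrite mulnC divnK// dvdn_gcdl.
have [e' bE] : exists e', b = (g * e')%N.
  by exists (b %/ g)%N; rewrite mulnC divnK// dvdn_gcdr.
have e0 : (0 < e)%N by move: a0; rewrite aE muln_gt0 => /andP[].
have eR : e%:R != 0 :> R by rewrite pnatr_eq0 -lt0n.
have gR : g%:R != 0 :> R by rewrite pnatr_eq0 -lt0n.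
have aER : a%:R = g%:R * e%:R :> R by rewrite aE natrM.
have bER : b%:R = g%:R * e'%:R :> R by rewrite bE natrM.
have cop : coprime e e'.
  rewrite /coprime -(eqn_pmul2l g0) muln_gcdr -aE -bE muln1; exact/eqP.
pose F p := near_ind d (e'%:R * p%:R / e%:R + w).
have -> : \sum_(p < a) near_ind d (b%:R * p%:R / a%:R + w) = \sum_(p < g * e) F p.
  rewrite -aE; apply: eq_bigr => p _; congr (near_ind d (_ + w)).
  by rewrite [a%:R]aER [b%:R]bER; field; rewrite eR gR.
rewrite sum_ord_mul; last first.
  move=> p; rewrite /F natrD mulrDr mulrDl mulfK// addrAC.
  by rewrite ind_natD.
have h : \sum_(p < e) F p = \sum_(l < e) near_ind d (l%:R / e%:R + w).
  (* Multiplication by [e'] permutes the residues modulo [e], as [e] and [e'] are coprime. *)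
  pose s (p : 'I_e) := Ordinal (ltn_pmod (e' * p) e0).
  have s_inj : injective s.
    move=> p q /(congr1 val)/= /eqP.
    wlog le_pq : p q / (p <= q)%N.
      move=> H; case/orP: (leq_total p q) => h; first exact: H.
      by rewrite eq_sym => k; apply/esym; apply: H.
    rewrite eq_sym eqn_mod_dvd ?leq_mul2l ?le_pq ?orbT// -mulnBr Gauss_dvdr//.
    move=> /dvdn_leq h; apply/val_inj/eqP; rewrite eqn_leq le_pq/= -subn_eq0.
    case: posnP h => // k /(_ isT); rewrite leqNgt.
    by rewrite (leq_ltn_trans (leq_subr _ _) (ltn_ord q)).
  rewrite [RHS](reindex_inj s_inj); apply: eq_bigr => p _.
  rewrite /F -[RHS](ind_natD d _ (e' * p %/ e)).
  congr (near_ind d _); rewrite -natrM {1}(divn_eq (e' * p) e) natrD natrM /=.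
  by field.
rewrite h; apply: le_trans (_ : g%:R * (2 * d * e%:R + 1) <= _).
  by rewrite ler_wpM2l// sum_ind_grid.
rewrite [a%:R]aER -/g le_eqVlt; apply/orP; left; apply/eqP; ring.
Qed.

(** When the unit interval is cut into [a] pieces, the first factor becomes the same function of [t]
    on every piece. The second factor, summed over the pieces, is a progression sum bounded
    uniformly in [t]. *)
Lemma I01_ind_overlap (a b : nat) d d' c c' : (0 < a)%N -> 
  0 <= d -> d <= 1/2 -> 0 <= d' ->
  (I01 (fun t => (near_ind d (a%:R * t + c) * near_ind d' (b%:R * t + c'))%:E) <=
    (2 * d * (2 * d' + (gcdn a b)%:R / a%:R))%:E)%E.
Proof.
move=> a0 d0 d1 d'0; have aR : 0 < a%:R :> R by rewrite ltr0n.
have nn x : (0 <= (near_ind d (a%:R * x + c) * near_ind d' (b%:R * x + c'))%:E)%E.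
  by rewrite lee_fin mulr_ge0// ind_ge0.
have mm : measurable_fun setT (fun t : R => (near_ind d (a%:R * t + c) * near_ind d' (b%:R * t + c'))%:E).
  by apply/measurable_EFinP; apply: measurable_funM; exact: measurable_ind_affine.
rewrite (I01_dilate a0)// /I01 -ge0_integral_sum//; last first.
  move=> p; apply: measurable_funTS; apply: measurableT_comp mm _.
  by apply: measurable_funM => //; exact: measurable_funD.
rewrite -ge0_integralZl//; last 2 first.
- apply: emeasurable_sum => p; apply: measurable_funTS; apply: measurableT_comp mm _.
  by apply: measurable_funM => //; exact: measurable_funD.
- by move=> t _; apply: sume_ge0 => p _.
pose k := 2 * d' + (gcdn a b)%:R / a%:R.
have k0 : 0 <= k by rewrite addr_ge0 ?mulr_ge0// divr_ge0.
apply: (@le_trans _ _ (I01 (fun t => (k * near_ind d (t + c))%:E))); last first.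
  rewrite /I01; under eq_integral do rewrite EFinM.
  rewrite ge0_integralZl//; last 2 first.
  - apply/measurable_EFinP; apply: measurable_funTS; apply: measurableT_comp (measurable_ind d) _.
    exact: measurable_funD.
  - by move=> t _; rewrite lee_fin ind_ge0.
  by rewrite -/(I01 _) I01_ind_shift// -EFinM lee_fin mulrC.
apply: ge0_le_integral => //.
- by move=> t _; apply: mule_ge0; [rewrite lee_fin invr_ge0 ltW|apply: sume_ge0].
- apply: measurable_funeM; apply: emeasurable_sum => p; apply: measurable_funTS.
  apply: measurableT_comp mm _.
  by apply: measurable_funM => //; exact: measurable_funD.
- apply/measurable_EFinP; apply: measurable_funTS; apply: measurable_funM => //.
  apply: measurableT_comp (measurable_ind d) _; exact: measurable_funD.
move=> t _; rewrite sumEFin -EFinM lee_fin.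
under eq_bigr => p _.
  rewrite (_ : near_ind d _ = near_ind d (t + c)); last first.
    rewrite mulrC mulfVK ?gt_eqF// addrAC; exact: ind_natD.
  rewrite (_ : _ * _ + c' = b%:R * p%:R / a%:R + (b%:R * t / a%:R + c')); last first.
    by field; rewrite gt_eqF.
  over.
rewrite -mulr_sumr mulrCA mulrC ler_wpM2r ?ind_ge0//.
rewrite ler_pdivrMl// (le_trans (sum_ind_progression _ _ _ _))//.
rewrite le_eqVlt; apply/orP; left; apply/eqP; by rewrite /k; field; rewrite gt_eqF.
Qed.

End OneDim.

(** * Functions of two coordinates: exchange of integrals and independence *)

Section TwoDim.
Context {R : realType}.
Local Notation mu := (@lebesgue_measure R).
Local Notation U01 := (@uniform_prob R 0 1 ltr01).

(** Passing to a probability measure gives access to product measures and Tonelli's theorem. *)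
Lemma uniform01E (f : R -> \bar R) : measurable_fun setT f -> (forall x, 0 <= f x)%E ->
  (\int[U01]_t f t = I01 f)%E.
Proof.
move=> mf f0; rewrite integral_uniform// subr0 invr1 mul1e /I01.
by rewrite integral_itv_bndo_bndc//; exact: measurable_funTS.
Qed.

Lemma eq_I01 (f g : R -> \bar R) : f =1 g -> I01 f = I01 g.
Proof. by move=> /funext ->. Qed.

Lemma I01_ge0 (f : R -> \bar R) : (forall x, 0 <= f x)%E -> (0 <= I01 f)%E.
Proof. by move=> f0; apply: integral_ge0. Qed.

Lemma I01Zl (f : R -> \bar R) (k : R) : measurable_fun setT f -> (forall x, 0 <= f x)%E ->
  0 <= k -> I01 (fun t => k%:E * f t)%E = (k%:E * I01 f)%E.
Proof. by move=> mf f0 k0; rewrite /I01 ge0_integralZl//; exact: measurable_funTS. Qed.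

Lemma I01_ecst (r : \bar R) : (0 <= r)%E -> I01 (fun=> r) = r.
Proof.
case: r => [r||] //; first by rewrite lee_fin; exact: I01_cst.
move=> _; rewrite /I01 integral_cst//= lebesgue_measure_itv/= lte_fin ltr01.
by rewrite oppr0 adde0 mule1.
Qed.

Lemma measurable_section d (T : measurableType d) (f : T * R -> \bar R) (x : T) :
  measurable_fun setT f -> measurable_fun setT (fun t => f (x, t)).
Proof. by move=> mf; apply: measurableT_comp mf _; exact: measurable_pair1. Qed.

Lemma measurable_I01 d (T : measurableType d) (f : T * R -> \bar R) :
  measurable_fun setT f -> (forall z, 0 <= f z)%E ->
  measurable_fun setT (fun x => I01 (fun t => f (x, t))).
Proof.
move=> mf f0; have := @measurable_fun_fubini_tonelli_F _ _ _ _ _ U01 f mf f0.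
congr (measurable_fun _ _); apply/funext => x; rewrite /fubini_F uniform01E//.
exact: measurable_section.
Qed.

Lemma I01_swap (f : R * R -> \bar R) : measurable_fun setT f -> (forall z, 0 <= f z)%E ->
  I01 (fun s => I01 (fun t => f (s, t))) = I01 (fun t => I01 (fun s => f (s, t))).
Proof.
move=> mf f0.
have mf' : measurable_fun setT (fun z : R * R => f (z.2, z.1)).
  by apply: measurableT_comp mf _; exact: measurable_fun_pair.
have := @fubini_tonelli _ _ _ _ _ U01 U01 f mf f0.
rewrite uniform01E; last 2 first.
- exact: (@measurable_fun_fubini_tonelli_F _ _ _ _ _ U01 f mf f0).
- by move=> x; apply: integral_ge0.
rewrite uniform01E; last 2 first.
- exact: (@measurable_fun_fubini_tonelli_G _ _ _ _ _ U01 f mf f0).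
- by move=> x; apply: integral_ge0.
rewrite (@eq_I01 _ (fun s => I01 (fun t => f (s, t)))); last first.
  by move=> s; rewrite uniform01E//; exact: measurable_section.
move=> ->; apply: eq_I01 => t; rewrite uniform01E//.
exact: (measurable_section t mf').
Qed.

(* Translating [(s, t)] shows that the double integral does not depend on [c'], so that
   it may be averaged over [c'] first. *)
Lemma I01_ind_indep (a b a' b' : nat) (d d' c c' : R) : (0 < a)%N -> (a * b' != a' * b)%N ->
  0 <= d -> d <= 1/2 -> 0 <= d' -> d' <= 1/2 ->
  I01 (fun s => I01 (fun t => (near_ind d (a%:R * s + b%:R * t + c) *
    near_ind d' (a'%:R * s + b'%:R * t + c'))%:E)) = (2 * d * (2 * d'))%:E.
Proof.
move=> a0 ab d0 d1 d'0 d'1.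
have D0 : a%:R * b'%:R - a'%:R * b%:R != 0 :> R by rewrite subr_eq0 -!natrM eqr_nat.
set D := (X in X != 0) in D0.
pose F (v : R) (z : R * R) := (near_ind d (a%:R * z.1 + b%:R * z.2 + c) *
    near_ind d' (a'%:R * z.1 + b'%:R * z.2 + c' + v))%:E.
have mlin (x y k : R) : measurable_fun setT (fun z : R * R => x * z.1 + y * z.2 + k).
  apply: measurable_funD => //; apply: measurable_funD; apply: measurable_funM => //.
have mF v : measurable_fun setT (F v).
  apply/measurable_EFinP; apply: measurable_funM.
    exact: measurableT_comp (measurable_ind d) (mlin _ _ _).
  under eq_fun do rewrite -addrA.
  exact: measurableT_comp (measurable_ind d') (mlin _ _ _).
have F0 v z : (0 <= F v z)%E by rewrite lee_fin mulr_ge0// ind_ge0.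
pose K v := I01 (fun s => I01 (fun t => F v (s, t))).
have KE v : K v = K 0.
  (* Cramer's rule for [a u + b w = 0] and [a' u + b' w = v]. *)
  pose u := - b%:R * v / D; pose w := a%:R * v / D.
  have e1 s t : F v (s, t) = F 0 (s + u, t + w).
    rewrite /F /=; congr (near_ind d _ * near_ind d' _)%:E; rewrite /u /w /D; field; exact: D0.
  have F1 s t : F 0 (s, t + 1) = F 0 (s, t).
    rewrite /F /=; congr (_ * _)%:E.
      by rewrite -[RHS](ind_natD d _ b); congr near_ind; ring.
    by rewrite -[RHS](ind_natD d' _ b'); congr near_ind; ring.
  have F2 s t : F 0 (s + 1, t) = F 0 (s, t).
    rewrite /F /=; congr (_ * _)%:E.
      by rewrite -[RHS](ind_natD d _ a); congr near_ind; ring.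
    by rewrite -[RHS](ind_natD d' _ a'); congr near_ind; ring.
  rewrite /K (eq_I01 (fun s => eq_I01 (e1 s))).
  rewrite (@eq_I01 _ (fun s => I01 (fun t => F 0 (s + u, t)))); last first.
    move=> s; apply: (I01_shift (f := fun t => F 0 (s + u, t))) => //.
    exact: measurable_section.
  apply: (I01_shift (f := fun s => I01 (fun t => F 0 (s, t)))).
  - exact: measurable_I01.
  - by move=> s; exact: I01_ge0.
  - by move=> s; apply: eq_I01 => t.
transitivity (K 0); first by apply: eq_I01 => s; apply: eq_I01 => t; rewrite /F/= addr0.
rewrite -[LHS]I01_ecst; last by apply: I01_ge0 => s; exact: I01_ge0.
rewrite -(eq_I01 KE) /K.
have mG : measurable_fun setT (fun z : R * R * R => F z.1.1 (z.1.2, z.2)).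
  have m11 : measurable_fun setT (fun z : R * R * R => z.1.1).
    exact: measurableT_comp measurable_fst measurable_fst.
  have m12 : measurable_fun setT (fun z : R * R * R => z.1.2).
    exact: measurableT_comp measurable_snd measurable_fst.
  have m2 : measurable_fun setT (fun z : R * R * R => z.2) by exact: measurable_snd.
  apply/measurable_EFinP; apply: measurable_funM.
    apply: measurableT_comp (measurable_ind d) _.
    by apply: measurable_funD => //; apply: measurable_funD => //; apply: measurable_funM.
  apply: measurableT_comp (measurable_ind d') _.
  by apply: measurable_funD => //; apply: measurable_funD => //; apply: measurable_funD => //; apply: measurable_funM.
(* This exchange and the next one bring [v] innermost, where it merely translates the second factor,
   which then integrates to [2 * d']. *)
rewrite (I01_swap (f := fun z => I01 (fun t => F z.1 (z.2, t)))); last 2 first.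
- exact: (measurable_I01 mG).
- by move=> z; exact: I01_ge0.
transitivity (I01 (fun s => I01 (fun t => ((2 * d')%:E * (near_ind d (a%:R * s + b%:R * t + c))%:E)%E))).
  apply: eq_I01 => s /=.
  rewrite (I01_swap (f := fun z => F z.1 (s, z.2)))//; last first.
    have : measurable_fun setT (fun z : R * R => (z.1, s, z.2)).
      by apply: measurable_fun_pair => //; apply: measurable_fun_pair.
    exact: measurableT_comp mG.
  apply: eq_I01 => t /=; rewrite /F /=.
  under eq_I01 do rewrite EFinM.
  rewrite I01Zl ?ind_ge0//; last 2 first.
  - apply/measurable_EFinP; have := @measurable_ind_affine R d' 1 (a'%:R * s + b'%:R * t + c').
    by under eq_fun do rewrite mul1r addrC.
  - by move=> v; rewrite lee_fin ind_ge0.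
  rewrite muleC; congr (_ * _)%E.
  under eq_I01 do rewrite addrC.
  exact: I01_ind_shift.
rewrite (I01_swap (f := fun z => ((2 * d')%:E * (near_ind d (a%:R * z.1 + b%:R * z.2 + c))%:E)%E)); last 2 first.
- apply: measurable_funeM; apply/measurable_EFinP.
  exact: measurableT_comp (measurable_ind d) (mlin _ _ _).
- by move=> z; rewrite mule_ge0// lee_fin ?ind_ge0 ?mulr_ge0.
rewrite (@eq_I01 _ (fun=> (2 * d * (2 * d'))%:E)) ?I01_cst ?mulr_ge0// => t /=.
under eq_I01 do rewrite -addrA.
rewrite I01Zl; last 3 first.
- by apply/measurable_EFinP; exact: measurable_ind_affine.
- by move=> v; rewrite lee_fin ind_ge0.
- by rewrite mulr_ge0.
by rewrite I01_ind_dilate// -EFinM mulrC.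
Qed.

End TwoDim.

(** * The uniform distribution on the cube *)
Section Cube.
Context {R : realType} {I : finType}.
Local Notation U01 := (@uniform_prob R 0 1 ltr01).

Notation cube := (#|I|.-tuple R).
Implicit Types (x : cube) (i j : I) (f : cube -> \bar R).

(* Points are tuples because the library provides the product sigma-algebra for tuples
   but not for matrices or finite functions. *)
Definition crd x i : R := tnth x (enum_rank i).

Definition upd x i (t : R) : cube :=
  [tuple (if k == enum_rank i then t else tnth x k) | k < #|I|].

Lemma crd_upd x i t j : crd (upd x i t) j = if j == i then t else crd x j.
Proof. by rewrite /crd tnth_mktuple (inj_eq enum_rank_inj). Qed.

Lemma crd_inj x x' : crd x =1 crd x' -> x = x'.
Proof.
move=> h; apply: eq_from_tnth => k.
by have := h (enum_val k); rewrite /crd enum_valK.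
Qed.

Lemma upd_upd x i s t : upd (upd x i s) i t = upd x i t.
Proof. by apply: crd_inj => j; rewrite !crd_upd; case: eqP. Qed.

Lemma updC x i j s t : i != j -> upd (upd x i s) j t = upd (upd x j t) i s.
Proof.
move=> ij; apply: crd_inj => k; rewrite !crd_upd.
case: (eqVneq k j) => [->|//]; by rewrite eq_sym (negbTE ij).
Qed.

Lemma measurable_crd i : measurable_fun setT (crd ^~ i).
Proof. exact: measurable_tnth. Qed.

Lemma measurable_upd i : measurable_fun setT (fun z : cube * R => upd z.1 i z.2).
Proof.
apply/measurable_fun_tnthP => k.
have h : measurable_fun setT (fun z : cube * R => tnth z.1 k).
  apply: (@measurableT_comp _ _ _ _ _ _ (fun x : cube => tnth x k) _ fst) => //.
  exact: measurable_tnth.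
rewrite (_ : _ \o _ = fun z => if k == enum_rank i then z.2 else tnth z.1 k).
  by case: eqP => _ //; exact: measurable_snd.
by apply/funext => z /=; rewrite tnth_mktuple.
Qed.

(** The conditional expectation of [f] given the coordinates other than [i], for the uniform
    distribution. *)
Definition avg i f x : \bar R := I01 (fun t => f (upd x i t)).

Lemma measurable_upd_comp i f : measurable_fun setT f ->
  measurable_fun setT (fun z : cube * R => f (upd z.1 i z.2)).
Proof. by move=> mf; exact: measurableT_comp mf (measurable_upd i). Qed.

Lemma measurable_upd_r i f x : measurable_fun setT f ->
  measurable_fun setT (fun t => f (upd x i t)).
Proof. by move=> mf; exact: (measurable_section x (measurable_upd_comp i mf)). Qed.

Lemma measurable_avg i f : measurable_fun setT f -> (forall x, 0 <= f x)%E ->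
  measurable_fun setT (avg i f).
Proof.
by move=> mf f0; exact: (measurable_I01 (measurable_upd_comp i mf)).
Qed.

Lemma avg_ge0 i f x : (forall x, 0 <= f x)%E -> (0 <= avg i f x)%E.
Proof. by move=> f0; exact: I01_ge0. Qed.

Lemma avg_idem i f : (forall x, 0 <= f x)%E -> avg i (avg i f) = avg i f.
Proof.
move=> f0; apply/funext => x; rewrite /avg.
under eq_I01 => s do under eq_I01 => t do rewrite upd_upd.
by rewrite I01_ecst//; exact: I01_ge0.
Qed.

Lemma avgC i j f : measurable_fun setT f -> (forall x, 0 <= f x)%E -> i != j ->
  avg i (avg j f) = avg j (avg i f).
Proof.
move=> mf f0 ij; apply/funext => x; rewrite /avg.
pose h (z : R * R) := f (upd (upd x i z.1) j z.2).
have mh : measurable_fun setT h.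
  apply: measurableT_comp mf _.
  have mx : measurable_fun setT (fun z : R * R => upd x i z.1).
    have mp : measurable_fun setT (fun z : R * R => (x, z.1)).
      exact: measurable_fun_pair.
    by have := measurableT_comp (measurable_upd i) mp.
  have mp := measurable_fun_pair mx measurable_snd.
  by have := measurableT_comp (measurable_upd j) mp.
have hsw := I01_swap mh (fun z => f0 _).
transitivity (I01 (fun t => I01 (fun s => h (s, t)))); first exact: hsw.
by apply: eq_I01 => t; apply: eq_I01 => s; rewrite /h /= updC.
Qed.

(* Start from a Dirac mass and resample the coordinates in [s] one after the other. *)
Lemma exists_uniform_seq (s : seq I) : exists P : probability cube R,
  forall i f, i \in s -> measurable_fun setT f -> (forall x, 0 <= f x)%E ->
  (\int[P]_x avg i f x = \int[P]_x f x)%E.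
Proof.
elim: s => [|k s [P HP]].
  by exists (dirac ([tuple 0 | _ < #|I|] : cube)).
pose Y : measurableType _ := measurableTypeR R.
pose X : (cube * Y)%type -> cube := fun z => upd z.1 k z.2.
have mX0 : measurable_fun setT X by exact: measurable_upd.
pose mX := isMeasurableFun.Build _ _ _ _ X mX0.
pose XX : {mfun (cube * Y)%type >-> cube} := HB.pack X mX.
exists (distribution (P \x U01)%E XX).
(* Integrating [f] for the new law is integrating [avg k f] for [P]. Invariance under [avg i] then
   follows from idempotence if [i = k], and otherwise from commutation and the invariance of [P]. *)
have H f : measurable_fun setT f -> (forall x, 0 <= f x)%E ->
    (\int[distribution (P \x U01)%E XX]_x f x = \int[P]_x avg k f x)%E.
  move=> mf f0; rewrite ge0_integral_pushforward// preimage_setT.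
  have mfX : measurable_fun setT (f \o X) by exact: measurableT_comp mf mX0.
  rewrite (@fubini_tonelli1 _ _ _ _ _ _ _ (f \o X) mfX); last by move=> z; exact: f0.
  apply: eq_integral => x _; rewrite /fubini_F uniform01E//; last by move=> t; exact: f0.
  exact: measurable_upd_r.
move=> i f; rewrite inE => iks mf f0.
rewrite !H//; [|exact: measurable_avg|by move=> x; exact: avg_ge0].
have [->|ik] := eqVneq i k; first by rewrite avg_idem.
move: iks; rewrite (negbTE ik)/= => si.
have ki : k != i by rewrite eq_sym.
rewrite (avgC mf f0 ki); apply: HP => //; first exact: measurable_avg.
by move=> x; exact: avg_ge0.
Qed.

(** Invariance under resampling of each coordinate determines the product of the uniform
    distributions. *)
Definition uniform_cube (P : probability cube R) := forall i f, measurable_fun setT f ->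
  (forall x, 0 <= f x)%E -> (\int[P]_x avg i f x = \int[P]_x f x)%E.

Lemma exists_uniform_cube : exists P, uniform_cube P.
Proof.
have [P HP] := exists_uniform_seq (enum I); exists P => i f; apply: HP.
by rewrite mem_enum.
Qed.

Definition avg_seq (s : seq I) f := foldr avg f s.

Lemma avg_seq_ge0 s f x : (forall x, 0 <= f x)%E -> (0 <= avg_seq s f x)%E.
Proof. by move=> f0; elim: s x => [|i s IH] x //=; exact: avg_ge0. Qed.

Lemma measurable_avg_seq s f : measurable_fun setT f -> (forall x, 0 <= f x)%E ->
  measurable_fun setT (avg_seq s f).
Proof.
move=> mf f0; elim: s => [|i s IH] //=; apply: measurable_avg => // x.
exact: avg_seq_ge0.
Qed.

(** As [h] ignores the coordinates in [s], it is a constant in each of the successive integrals. *)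
Lemma avg_seq_mull s (h : cube -> R) f : measurable_fun setT f -> (forall x, 0 <= f x)%E ->
  (forall x, 0 <= h x) -> (forall i x t, i \in s -> h (upd x i t) = h x) ->
  avg_seq s (fun x => (h x)%:E * f x)%E = (fun x => (h x)%:E * avg_seq s f x)%E.
Proof.
move=> mf f0 h0; elim: s => [|i s IH] hs //=.
rewrite IH; last by move=> j x t js; rewrite hs// inE js orbT.
apply/funext => x; rewrite /avg.
under eq_I01 do rewrite hs ?mem_head//.
rewrite I01Zl//; last by move=> t; exact: avg_seq_ge0.
by apply: measurable_upd_r; exact: measurable_avg_seq.
Qed.

Section Uniform.
Variables (P : probability cube R) (unifP : uniform_cube P).

Lemma integral_avg_seq s f : measurable_fun setT f -> (forall x, 0 <= f x)%E ->
  (\int[P]_x avg_seq s f x = \int[P]_x f x)%E.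
Proof.
move=> mf f0; elim: s => [|i s IH] //=.
rewrite unifP//; first exact: measurable_avg_seq.
by move=> x; exact: avg_seq_ge0.
Qed.

Lemma integral_prob1 : (\int[P]_x 1%:E = 1)%E.
Proof. by rewrite integral_cst// mul1e; exact: probability_setT. Qed.

Section Product.
Variables (K : eqType) (g : K -> cube -> R) (s : K -> seq I) (beta : K -> R).
Hypothesis mg : forall k, measurable_fun setT (g k).
Hypothesis g0 : forall k x, 0 <= g k x.
Hypothesis gs : forall k k' i x t, k != k' -> i \in s k' -> g k (upd x i t) = g k x.
Hypothesis beta0 : forall k, 0 <= beta k.

Let G r x := \prod_(k <- r) g k x.

Let mG r : measurable_fun setT (G r).
Proof. by apply: measurable_prod => k _. Qed.

Let G0 r x : 0 <= G r x. Proof. exact: prodr_ge0. Qed.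

(** Integrating out the coordinates in [s k] affects the factor [g k] alone. *)
Let step k r : k \notin r ->
  (\int[P]_x (G (k :: r) x)%:E = \int[P]_x ((G r x)%:E * avg_seq (s k) (EFin \o g k) x))%E.
Proof.
move=> kr; rewrite -(@integral_avg_seq (s k)); last 2 first.
- by apply/measurable_EFinP; exact: mG.
- by move=> x; rewrite lee_fin.
congr (integral _ _ _).
rewrite -(@avg_seq_mull (s k) (G r) (EFin \o g k))//.
- by congr avg_seq; apply/funext => x /=; rewrite /G big_cons EFinM muleC.
- exact/measurable_EFinP.
- by move=> x /=; rewrite lee_fin.
- move=> i x t isk; rewrite /G !big_seq; apply: eq_bigr => k' k'r; rewrite (@gs k' k)//.
  by apply: contraNneq kr => <-.
Qed.

(** The bound on the average of each factor is uniform in the remaining coordinates, so the factors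
    can be removed one at a time as if they were independent. *)
Lemma integral_prod_le r : uniq r ->
  (forall k x, avg_seq (s k) (EFin \o g k) x <= (beta k)%:E)%E ->
  (\int[P]_x (\prod_(k <- r) g k x)%:E <= (\prod_(k <- r) beta k)%:E)%E.
Proof.
move=> + Hb; elim: r => [_|k r IH /= /andP[kr ur]].
  under eq_integral do rewrite big_nil.
  by rewrite big_nil integral_prob1.
rewrite step// big_cons EFinM.
apply: (@le_trans _ _ (\int[P]_x ((beta k)%:E * (G r x)%:E))%E).
  apply: ge0_le_integral => //.
  - by move=> x _; rewrite mule_ge0 ?lee_fin//; apply: avg_seq_ge0 => y; rewrite lee_fin.
  - apply: emeasurable_funM; first exact/measurable_EFinP.
    by apply: measurable_avg_seq; [exact/measurable_EFinP|move=> y; rewrite lee_fin].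
  - by apply: measurable_funeM; exact/measurable_EFinP.
  - by move=> x _; rewrite muleC lee_wpmul2r ?lee_fin.
rewrite ge0_integralZl ?lee_fin//; last 2 first.
- exact/measurable_EFinP.
- by move=> x _; rewrite lee_fin.
by rewrite lee_wpmul2l ?lee_fin ?IH.
Qed.

Lemma integral_prod_ge r : uniq r ->
  (forall k x, (beta k)%:E <= avg_seq (s k) (EFin \o g k) x)%E ->
  ((\prod_(k <- r) beta k)%:E <= \int[P]_x (\prod_(k <- r) g k x)%:E)%E.
Proof.
move=> + Hb; elim: r => [_|k r IH /= /andP[kr ur]].
  under eq_integral do rewrite big_nil.
  by rewrite big_nil integral_prob1.
rewrite step// big_cons EFinM.
apply: (@le_trans _ _ (\int[P]_x ((beta k)%:E * (G r x)%:E))%E); last first.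
  apply: ge0_le_integral => //.
  - by move=> x _; rewrite mule_ge0 ?lee_fin.
  - by apply: measurable_funeM; exact/measurable_EFinP.
  - apply: emeasurable_funM; first exact/measurable_EFinP.
    by apply: measurable_avg_seq; [exact/measurable_EFinP|move=> y; rewrite lee_fin].
  - by move=> x _; rewrite muleC lee_wpmul2l ?lee_fin.
rewrite ge0_integralZl ?lee_fin//; last 2 first.
- exact/measurable_EFinP.
- by move=> x _; rewrite lee_fin.
by rewrite lee_wpmul2l ?lee_fin ?IH.
Qed.

End Product.

End Uniform.

End Cube.

(** * Systems of linear forms *)
Section CubeProbability.
Context {R : realType} {I : finType}.
Notation cube := (#|I|.-tuple R).
Variables (P : probability cube R) (unifP : uniform_cube P).
Local Notation mu := (@lebesgue_measure R).

Section Inter.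
Variables (K : finType) (B : K -> set cube) (s : K -> seq I) (beta : K -> R).
Hypothesis mB : forall k, measurable (B k).
Hypothesis Bs : forall k k' i x t, k != k' -> i \in s k' -> B k (upd x i t) = B k x.
Hypothesis beta0 : forall k, 0 <= beta k.

Let indB_upd k k' i x t : k != k' -> i \in s k' ->
  \1_(B k) (upd x i t) = \1_(B k) x :> R.
Proof.
by move=> kk' ik; rewrite !indicE; congr (_%:R); congr nat_of_bool;
  apply/idP/idP; rewrite !inE (Bs x t kk' ik).
Qed.

Let prob_forallE : (P [set x | forall k, B k x] =
  \int[P]_x (\prod_(k <- index_enum K) (\1_(B k) x : R))%:E)%E.
Proof.
rewrite -[in LHS](setIT [set x | _]) -integral_indic//; last first.
  rewrite (_ : [set x | _] = \bigcap_(k in [set` predT : {pred K}]) B k).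
    by apply: fin_bigcap_measurable => //; exact: finite_finset.
  by apply/seteqP; split => x; [move=> h k _|move=> h k]; exact: h.
apply: eq_integral => x _; congr EFin; rewrite indicE.
have [h|nh] := pselect (forall k, B k x).
  by rewrite mem_set// big1// => k _; rewrite indicE mem_set.
rewrite memNset//; move/existsNP : nh => [k nk].
by rewrite (bigD1 k)//= indicE memNset// mul0r.
Qed.

Lemma prob_forall_le : (forall k x, avg_seq (s k) (fun x => (\1_(B k) x)%:E) x <= (beta k)%:E)%E ->
  (P [set x | forall k, B k x] <= (\prod_k beta k)%:E)%E.
Proof.
move=> H; rewrite prob_forallE.
apply: (@integral_prod_le _ _ P unifP K (fun k => \1_(B k)) s) => //.
exact: index_enum_uniq.
Qed.

Lemma prob_forall_ge : (forall k x, (beta k)%:E <= avg_seq (s k) (fun x => (\1_(B k) x)%:E) x)%E ->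
  ((\prod_k beta k)%:E <= P [set x | forall k, B k x])%E.
Proof.
move=> H; rewrite prob_forallE.
apply: (@integral_prod_ge _ _ P unifP K (fun k => \1_(B k)) s) => //.
exact: index_enum_uniq.
Qed.

End Inter.

Lemma measurable_crd_itv (i : I) (a b : R) : measurable [set x : cube | a <= crd x i <= b].
Proof.
rewrite (_ : [set x | _] = setT `&` (crd ^~ i) @^-1` `[a, b]%classic).
  by apply: measurable_crd.
by rewrite setTI; apply/seteqP; split => x /=; rewrite in_itv.
Qed.

(** An inequality, since [[a, b]] may stick out of the unit interval. *)
Lemma I01_itv_le (a b : R) :
  (I01 (fun t => (\1_`[a, b] t)%:E) <= (Num.max 0 (b - a)%R)%:E)%E.
Proof.
rewrite /I01 integral_indic//.
apply: (@le_trans _ _ (mu `[a, b])); first by apply: le_measure; rewrite ?inE//; exact: measurableI.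
rewrite lebesgue_measure_itv/= lte_fin; case: ifPn => h; last by rewrite lee_fin le_max lexx.
by rewrite -EFinB lee_fin le_max lexx orbT.
Qed.

Lemma crd_itv_indep (a b : I -> R) i j x t : i != j ->
  (a i <= crd (upd x j t) i <= b i) = (a i <= crd x i <= b i).
Proof. by move=> ij; rewrite crd_upd (negbTE ij). Qed.

(** The link between [P] and the volumes in the definition of the outer measure: each coordinate
    contributes one factor and is integrated out on its own. *)
Lemma prob_box_le (a b : I -> R) :
  (P [set x | forall i, (a i <= crd x i <= b i)%R] <= (\prod_i Num.max 0%R (b i - a i)%R)%:E)%E.
Proof.
apply: (@prob_forall_le I (fun i => [set x | a i <= crd x i <= b i]) (fun i => [:: i])).
- by move=> i; exact: measurable_crd_itv.
- move=> i j k x t ij; rewrite inE => /eqP -> /=; by rewrite crd_itv_indep.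
- by move=> i; rewrite le_max lexx.
move=> i x /=; apply: le_trans (I01_itv_le (a i) (b i)).
rewrite /avg le_eqVlt; apply/orP; left; apply/eqP; apply: eq_I01 => t; congr EFin.
rewrite !indicE; congr (_%:R); congr nat_of_bool.
by apply/idP/idP; rewrite !inE /= in_itv/= crd_upd eqxx.
Qed.

Lemma prob_unit_box : (P [set x | forall i : I, (0 <= crd x i <= 1)%R] = 1)%E.
Proof.
apply/eqP; rewrite eq_le; apply/andP; split.
  apply: (le_trans (prob_box_le (fun=> 0) (fun=> 1))).
  by rewrite big1 ?lee_fin// => i _; rewrite subr0 max_r.
apply: le_trans (@prob_forall_ge I (fun i => [set x | 0 <= crd x i <= 1]) (fun i => [:: i]) (fun=> 1) _ _ _ _) => //.
- by rewrite big1.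
- by move=> i; exact: measurable_crd_itv.
- move=> i j k x t ij; rewrite inE => /eqP -> /=; by rewrite crd_upd (negbTE ij).
move=> i x /=; rewrite /avg -(I01_cst (@ler01 R)) le_eqVlt; apply/orP; left; apply/eqP.
apply: eq_integral => t; rewrite inE/= in_itv/= => /andP[t0 t1].
by rewrite indicE mem_set//= crd_upd eqxx t0 ltW.
Qed.

End CubeProbability.

(** * Approximation events of integer vectors and their intersections *)

Section LinearForms.
Context {R : realType} (n m : nat).
Notation I := ('I_n.+1 * 'I_m)%type.
Notation cube := (#|{: I}|.-tuple R).
Variables (P : probability cube R) (unifP : @uniform_cube R {: I} P) (y : 'rV[R]_m).
Implicit Types (q : 'I_n.+1 -> nat) (d : R) (x : cube).

Definition lin q x (j : 'I_m) : R := \sum_i (q i)%:R * crd x (i, j) - y ord0 j.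

Definition approx_set d q : set cube := [set x | forall j, nearZ d (lin q x j)].

Lemma lin_upd_neq q x k j j' t : j != j' -> lin q (upd x (k, j') t) j = lin q x j.
Proof.
move=> jj; rewrite /lin; congr (_ - _); apply: eq_bigr => i _.
by rewrite crd_upd xpair_eqE (negbTE jj) andbF.
Qed.

Lemma lin_upd q x k j t : lin q (upd x (k, j) t) j =
  (q k)%:R * t + (\sum_(i | i != k) (q i)%:R * crd x (i, j) - y ord0 j).
Proof.
rewrite /lin (bigD1 k)//= crd_upd eqxx -addrA; congr (_ + (_ - _)).
by apply: eq_bigr => i ik; rewrite crd_upd xpair_eqE (negbTE ik).
Qed.

Lemma lin_upd2 q x k l j s t : k != l -> lin q (upd (upd x (k, j) s) (l, j) t) j =
  (q k)%:R * s + (q l)%:R * t +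
  (\sum_(i | (i != l) && (i != k)) (q i)%:R * crd x (i, j) - y ord0 j).
Proof.
move=> kl; rewrite lin_upd (bigD1 k)//= crd_upd eqxx.
rewrite -[RHS]addrA [RHS]addrCA; congr (_ + _); rewrite -addrA; congr (_ + (_ - _)).
by apply: eq_bigr => i /andP[_ ik]; rewrite crd_upd xpair_eqE (negbTE ik).
Qed.

Lemma measurable_lin q j : measurable_fun setT (lin q ^~ j).
Proof.
rewrite /lin; apply: measurable_funB => //.
by apply: measurable_sum => i; apply: measurable_funM => //; exact: measurable_crd.
Qed.

Lemma measurable_near_lin d q j : measurable [set x | nearZ d (lin q x j)].
Proof.
rewrite -[X in measurable X]setTI; apply: (@measurable_lin q j) => //.
exact: measurable_nearZ.
Qed.

Lemma measurable_approx_set d q : measurable (approx_set d q).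
Proof.
rewrite (_ : approx_set d q = \bigcap_(j in [set` predT : {pred 'I_m}]) [set x | nearZ d (lin q x j)]).
  apply: fin_bigcap_measurable => [|j _]; first exact: finite_finset.
  exact: measurable_near_lin.
by apply/seteqP; split => x; [move=> h k _|move=> h k]; exact: h.
Qed.

(** The conditions on different columns of [x] involve different coordinates. Within a column it is
    enough to integrate out the entry in the first row, whose coefficient is positive. *)
Lemma prob_approx_set_ge d q : (0 < q ord0)%N -> 0 <= d -> d <= 1/2 -> (((2 * d) ^+ m)%:E <= P (approx_set d q))%E.
Proof.
move=> q0 d0 d1.
have := @prob_forall_ge _ _ P unifP 'I_m (fun j => [set x | nearZ d (lin q x j)])
  (fun j => [:: (ord0, j)]) (fun=> 2 * d).
rewrite prodr_const card_ord; apply.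
- by move=> j; exact: measurable_near_lin.
- by move=> j j' i x t jj; rewrite inE => /eqP -> /=; rewrite lin_upd_neq.
- by move=> _; rewrite mulr_ge0.
move=> j x /=; rewrite /avg.
rewrite -(@I01_ind_dilate _ (q ord0) d (\sum_(i | i != ord0) (q i)%:R * crd x (i, j) - y ord0 j))//.
rewrite le_eqVlt; apply/orP; left; apply/eqP; apply: eq_I01 => t.
by rewrite indicE -lin_upd indE.
Qed.

Let near2 d d' q q' j := [set x | nearZ d (lin q x j) /\ nearZ d' (lin q' x j)].

Let measurable_near2 d d' q q' j : measurable (near2 d d' q q' j).
Proof. exact: measurableI (measurable_near_lin d q j) (measurable_near_lin d' q' j). Qed.

Let near2_indep d d' q q' k j j' x t : j != j' ->
  near2 d d' q q' j (upd x (k, j') t) = near2 d d' q q' j x.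
Proof. by move=> jj; rewrite /near2 /= !lin_upd_neq. Qed.

Let indic_near2 d d' q q' j x :
  \1_(near2 d d' q q' j) x = near_ind d (lin q x j) * near_ind d' (lin q' x j).
Proof.
rewrite indicE !indE -natrM mulnb; congr (_%:R); congr nat_of_bool.
by apply/idP/andP; rewrite inE => -[/asboolP ? /asboolP ?].
Qed.

Let approx_setIE d d' q q' : approx_set d q `&` approx_set d' q' = [set x | forall j, near2 d d' q q' j x].
Proof.
apply/seteqP; split => x; first by move=> [h h'] j; split; [exact: h|exact: h'].
by move=> h; split=> j; case: (h j).
Qed.

(** In every column only the entry in the first row is integrated out; this serves for parallel
    vectors. *)
Lemma prob_approx_setI_overlap d d' q q' : (0 < q ord0)%N -> 0 <= d -> d <= 1/2 -> 0 <= d' ->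
  (P (approx_set d q `&` approx_set d' q') <=
   ((2 * d * (2 * d' + (gcdn (q ord0) (q' ord0))%:R / (q ord0)%:R)) ^+ m)%R%:E)%E.
Proof.
move=> q0 d0 d1 d'0; rewrite approx_setIE.
have := @prob_forall_le _ _ P unifP 'I_m (near2 d d' q q')
  (fun j => [:: (ord0, j)]) (fun=> 2 * d * (2 * d' + (gcdn (q ord0) (q' ord0))%:R / (q ord0)%:R)).
rewrite prodr_const card_ord; apply => //.
- by move=> j j' i x t jj; rewrite inE => /eqP -> /=; rewrite near2_indep.
- by move=> _; rewrite !mulr_ge0// addr_ge0 ?mulr_ge0// divr_ge0.
move=> j x /=; rewrite /avg.
under eq_I01 do rewrite indic_near2 !lin_upd.
exact: I01_ind_overlap.
Qed.

(** A nonzero minor on the entries [ord0] and [i] makes the two forms independent once both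
    corresponding entries of a column are integrated out. *)
Lemma prob_approx_setI_indep d d' q q' i : (0 < q ord0)%N -> (q ord0 * q' i != q' ord0 * q i)%N ->
  0 <= d -> d <= 1/2 -> 0 <= d' -> d' <= 1/2 ->
  (P (approx_set d q `&` approx_set d' q') <= ((2 * d * (2 * d')) ^+ m)%:E)%E.
Proof.
move=> q0 qq d0 d1 d'0 d'1; rewrite approx_setIE.
have i0 : ord0 != i by apply: contraNneq qq => <-; rewrite mulnC.
have := @prob_forall_le _ _ P unifP 'I_m (near2 d d' q q')
  (fun j => [:: (ord0, j); (i, j)]) (fun=> 2 * d * (2 * d')).
rewrite prodr_const card_ord; apply => //.
- by move=> j j' k x t jj; rewrite !inE => /orP[] /eqP -> /=; rewrite near2_indep.
- by move=> _; rewrite !mulr_ge0.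
move=> j x /=; rewrite /avg.
under eq_I01 do under eq_I01 do rewrite indic_near2 !lin_upd2//.
by rewrite I01_ind_indep.
Qed.

End LinearForms.

(** * Second moment and arithmetic *)
Section SecondMoment.
Context d (T : measurableType d) {R : realType} (P : probability T R).
Variables (K : choiceType) (A : K -> set T) (r : seq K) (w : K -> R) (E : R).
Hypothesis mA : forall k, measurable (A k).
Hypothesis w0 : forall k, 0 <= w k.
Hypothesis wA : forall k, k \in r -> ((w k)%:E <= P (A k))%E.
Hypothesis AE : (\sum_(k <- r) \sum_(l <- r) P (A k `&` A l) <= E%:E)%E.
Let S := \sum_(k <- r) w k.
Let U := [set x | exists2 k, k \in r & A k x].

Lemma measurable_exists_seq : measurable U.
Proof.
rewrite (_ : U = \big[setU/set0]_(k <- r) A k); first exact: bigsetU_measurable.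
by rewrite -bigcup_seq; apply/seteqP; split => x [k kr kx]; exists k.
Qed.

(* Integrate the pointwise inequality [2 S c <= c^2 + S^2 1_U] for [c] the number of [A k] containing [x]. *)
Lemma second_moment : ((2 * S ^+ 2 - E)%:E <= (S ^+ 2)%:E * P U)%E.
Proof.
have S0 : 0 <= S by apply: sumr_ge0.
have mU := measurable_exists_seq.
pose c x : R := \sum_(k <- r) \1_(A k) x.
have pw x : 2 * S * c x <= \sum_(k <- r) \sum_(l <- r) \1_(A k `&` A l) x + S ^+ 2 * \1_U x.
  have -> : \sum_(k <- r) \sum_(l <- r) \1_(A k `&` A l) x = c x ^+ 2.
    rewrite expr2 /c big_distrl/=; apply: eq_bigr => k _; rewrite big_distrr/=.
    by apply: eq_bigr => l _; rewrite indicI.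
  have [xU|xU] := pselect (U x).
    rewrite [\1_U x]indicE mem_set// mulr1 -subr_ge0.
    by rewrite (_ : _ - _ = (c x - S) ^+ 2) ?sqr_ge0//; ring.
  have -> : c x = 0.
    rewrite /c big1_seq// => k /= kr; rewrite indicE memNset// => kx.
    by apply: xU; exists k.
  by rewrite mulr0 expr0n/= add0r mulr_ge0 ?sqr_ge0// indicE.
have mi (B : set T) : measurable B -> measurable_fun setT (fun x => (\1_B x : R)%:E).
  by move=> mB; apply/measurable_EFinP; exact: measurable_indic.
have Ii (B : set T) : measurable B -> (\int[P]_x (\1_B x : R)%:E = P B)%E.
  by move=> mB; rewrite integral_indic// setIT.
have i1 : (\int[P]_x (2 * S * c x)%:E = (2 * S)%:E * \sum_(k <- r) P (A k))%E.
  transitivity (\int[P]_x ((2 * S)%:E * \sum_(k <- r) (\1_(A k) x : R)%:E))%E.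
    by apply: eq_integral => x _; rewrite sumEFin -EFinM.
  rewrite ge0_integralZl//; last 3 first.
  - by apply: emeasurable_sum => k; exact: mi.
  - by move=> x _; apply: sume_ge0 => k _; rewrite lee_fin indicE.
  - by rewrite lee_fin mulr_ge0.
  rewrite ge0_integral_sum//.
  + by congr (_ * _)%E; apply: eq_bigr => k _; rewrite Ii.
  + by move=> k; exact: mi.
have mI k l : measurable (A k `&` A l) by exact: measurableI.
have i2 : (\int[P]_x (\sum_(k <- r) \sum_(l <- r) \1_(A k `&` A l) x + S ^+ 2 * \1_U x)%:E =
   \sum_(k <- r) \sum_(l <- r) P (A k `&` A l) + (S ^+ 2)%:E * P U)%E.
  transitivity (\int[P]_x (\sum_(k <- r) \sum_(l <- r) (\1_(A k `&` A l) x : R)%:E + (S ^+ 2)%:E * (\1_U x : R)%:E))%E.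
    apply: eq_integral => x _; rewrite EFinD EFinM; congr (_ + _)%E.
    by rewrite -sumEFin; apply: eq_bigr => k _; rewrite sumEFin.
  rewrite ge0_integralD//; last 4 first.
  - by move=> x _; apply: sume_ge0 => k _; apply: sume_ge0 => l _; rewrite lee_fin indicE.
  - by apply: emeasurable_sum => k; apply: emeasurable_sum => l; exact: mi.
  - by move=> x _; rewrite mule_ge0 ?lee_fin ?sqr_ge0// indicE.
  - by apply: measurable_funeM; exact: mi.
  congr (_ + _)%E.
    rewrite ge0_integral_sum//; last 2 first.
    - by move=> k; apply: emeasurable_sum => l; exact: mi.
    - by move=> k x _; apply: sume_ge0 => l _; rewrite lee_fin indicE.
    apply: eq_bigr => k _; rewrite ge0_integral_sum//.
    - by apply: eq_bigr => l _; rewrite Ii.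
    - by move=> l; exact: mi.
  rewrite ge0_integralZl ?lee_fin ?sqr_ge0//.
    by rewrite Ii.
  exact: mi.
have mc : measurable_fun setT (fun x => (2 * S * c x)%:E).
  apply/measurable_EFinP; apply: measurable_funM => //; apply: measurable_sum => k.
  exact: measurable_indic.
have : (\int[P]_x (2 * S * c x)%:E <= \int[P]_x (\sum_(k <- r) \sum_(l <- r) \1_(A k `&` A l) x + S ^+ 2 * \1_U x)%:E)%E.
  apply: ge0_le_integral => //.
  - move=> x _; rewrite lee_fin !mulr_ge0//; apply: sumr_ge0 => k _; by rewrite indicE.
  - apply/measurable_EFinP; apply: measurable_funD.
      by apply: measurable_sum => k; apply: measurable_sum => l; exact: measurable_indic.
    by apply: measurable_funM => //; exact: measurable_indic.
  - by move=> x _; rewrite lee_fin.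
rewrite i1 i2 => h.
(* The weights are lower bounds for the probabilities, so [2 S * S] is at most the integral of
   [2 S c]. *)
have SA : (S%:E <= \sum_(k <- r) P (A k))%E.
  by rewrite /S -sumEFin big_seq [leRHS]big_seq; apply: lee_sum => k kr; exact: wA.
rewrite EFinB leeBlDl// (le_trans _ (le_trans h _))//; last by rewrite leeD2r.
by rewrite expr2 mulrA EFinM lee_wpmul2l// lee_fin mulr_ge0.
Qed.

End SecondMoment.

(** * Elementary inequalities and a sum of gcds *)

Section Arithmetic.
Context {R : realType}.

Lemma sum_inv_sq (k : nat) : \sum_(e < k) ((e.+1)%:R ^- 2) <= 2 :> R.
Proof.
(* The subtracted term makes the induction telescope. *)
suff H j : \sum_(e < j.+1) ((e.+1)%:R ^- 2) <= 2 - j.+1%:R^-1 :> R.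
  case: k => [|k]; first by rewrite big_ord0.
  by rewrite (le_trans (H k))// lerBlDr lerDl invr_ge0.
elim: j => [|j IH]; first by rewrite big_ord1 /= expr1n invr1; lra.
rewrite big_ord_recr/= (le_trans (lerD IH (lexx _)))//.
rewrite -subr_ge0.
have j1 : 0 < j.+1%:R :> R by rewrite ltr0n.
have -> : j.+2%:R = j.+1%:R + 1 :> R by rewrite natr1.
set a : R := j.+1%:R in j1 *.
rewrite (_ : _ - _ = (a * (a + 1) ^+ 2)^-1); last by field; rewrite !gt_eqF// ltr_wpDl.
by rewrite invr_ge0 mulr_ge0 ?sqr_ge0// ltW.
Qed.

(** With [e = k / gcd k l] the ratio is [1 / e], and [l = a k / e] for some [1 <= a <= e]. A given
    [e] thus serves at most [e] values of [l], and the sum is at most that of [e * e ^ -3]. *)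
Lemma sum_gcd_ratio (k s : nat) : (0 < k)%N -> (3 <= s)%N ->
  \sum_(l < k) ((gcdn k l.+1)%:R / k%:R) ^+ s <= 2 :> R.
Proof.
move=> k0 s3; have kR : 0 < k%:R :> R by rewrite ltr0n.
(* The term of an equality of fractions [l / k = a / e], all three indices being shifted by one.
   Fractions [a / e] not in lowest terms only enlarge the sum. *)
pose t (l e a : nat) : R := (l.+1 * e.+1 == a.+1 * k)%N%:R * e.+1%:R ^- 3.
have t0 l e a : 0 <= t l e a by rewrite mulr_ge0// exprn_ge0.
apply: (@le_trans _ _ (\sum_(l < k) \sum_(e < k) \sum_(a < e.+1) t l e a)).
  apply: ler_sum => l _.
  pose g := gcdn k l.+1.
  have g0 : (0 < g)%N by rewrite gcdn_gt0 k0.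
  have gk : (g * (k %/ g) = k)%N by rewrite mulnC divnK// dvdn_gcdl.
  have gl : (g * (l.+1 %/ g) = l.+1)%N by rewrite mulnC divnK// dvdn_gcdr.
  have e0 : (0 < k %/ g)%N by rewrite divn_gt0// dvdn_leq// dvdn_gcdl.
  have a0 : (0 < l.+1 %/ g)%N by rewrite divn_gt0// dvdn_leq// dvdn_gcdr.
  have ek : ((k %/ g).-1 < k)%N by rewrite prednK// leq_div.
  have ae : ((l.+1 %/ g).-1 < (Ordinal ek).+1)%N.
    by rewrite /= !prednK// leq_div2r.
  rewrite (bigD1 (Ordinal ek))//= (bigD1 (Ordinal ae))//=.
  rewrite -addrA ler_wpDr//; last first.
    rewrite {1}/t /= !prednK//.
    have -> : (l.+1 * (k %/ g) == l.+1 %/ g * k)%N.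
      by apply/eqP; rewrite -{1}gl mulnAC gk mulnC.
    rewrite mul1r.
    have -> : (gcdn k l.+1)%:R / k%:R = (k %/ g)%:R^-1 :> R.
      have gkR : k%:R = g%:R * (k %/ g)%:R :> R by rewrite -natrM gk.
      rewrite -/g [X in _ / X]gkR; field.
      by rewrite !pnatr_eq0 -!lt0n g0 e0.
    rewrite exprVn lef_pV2 ?posrE ?exprn_gt0 ?ltr0n//.
    by apply: ler_weXn2l => //; rewrite ler1n.
  by rewrite addr_ge0//; apply: sumr_ge0 => *//; apply: sumr_ge0.
rewrite exchange_big/= (le_trans _ (sum_inv_sq k))//; apply: ler_sum => e _.
rewrite exchange_big/=.
apply: (@le_trans _ _ (\sum_(a < e.+1) e.+1%:R ^- 3)); last first.
  rewrite sumr_const card_ord le_eqVlt; apply/orP; left; apply/eqP.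
  rewrite -[LHS]mulr_natr; have : e.+1%:R != 0 :> R by rewrite pnatr_eq0.
  by set a : R := e.+1%:R => a0; field.
apply: ler_sum => a _; rewrite -mulr_suml ler_piMl ?exprn_ge0//.
have [[l0 hl0]|hn] := pselect (exists l : 'I_k, (l.+1 * e.+1 == a.+1 * k)%N).
  rewrite (bigD1 l0)//= hl0 big1 ?addr0// => l ll.
  case: eqP => // hl; case/eqP: ll; apply/val_inj/eqP.
  by move: hl; rewrite -(eqP hl0) => /eqP; rewrite eqn_pmul2r// eqSS.
by rewrite big1// => l _; case: eqP => // hl; case: hn; exists l; exact/eqP.
Qed.

(** Choose [h] with [(1 + h) ^ m <= 1 + eps]. If [b <= h a], the first term suffices; otherwise
    [a < b / h], and the second one does with [C = (1 / h + 1) ^ m]. *)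
Lemma exprD_le_eps (m : nat) (eps : R) : 0 < eps -> exists2 C : R, 0 <= C &
  forall a b, 0 <= a -> 0 <= b -> (a + b) ^+ m <= (1 + eps) * a ^+ m + C * b ^+ m.
Proof.
move=> e0.
(* On [[0, 1]] the convex function [(1 + h) ^ j] lies below its chord. *)
have bern (j : nat) (h : R) : 0 <= h -> h <= 1 -> (1 + h) ^+ j <= 1 + (2 ^+ j - 1) * h.
  move=> h0 h1; elim: j => [|j IH]; first by rewrite !expr0 subrr mul0r addr0.
  rewrite exprS (le_trans (ler_wpM2l _ IH)) ?addr_ge0//.
  have p1 : 1 <= 2 ^+ j :> R by apply: exprn_ege1; rewrite ler1n.
  rewrite exprS -subr_ge0 (_ : _ - _ = (2 ^+ j - 1) * h * (1 - h)); last by ring.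
  by rewrite !mulr_ge0// subr_ge0.
pose h := Num.min 1 (eps / 2 ^+ m).
have p0 : 0 < 2 ^+ m :> R by rewrite exprn_gt0.
have h0 : 0 < h by rewrite lt_min ltr01 divr_gt0.
have h1 : h <= 1 by rewrite ge_min lexx.
have he : (1 + h) ^+ m <= 1 + eps.
  apply: (le_trans (bern m h (ltW h0) h1)); rewrite lerD2l.
  apply: (@le_trans _ _ (2 ^+ m * h)); first by rewrite ler_wpM2r// ?ltW//; lra.
  by rewrite mulrC -ler_pdivlMr// ge_min lexx orbT.
exists ((h^-1 + 1) ^+ m); first by rewrite exprn_ge0// addr_ge0// invr_ge0 ltW.
move=> a b a0 b0; have [bh|bh] := leP b (h * a).
  apply: (@le_trans _ _ ((1 + eps) * a ^+ m)).
    rewrite (le_trans _ (ler_wpM2r _ he)) ?exprn_ge0// -exprMn.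
    apply: lerXn2r; rewrite ?nnegrE ?mulr_ge0 ?addr_ge0//; first by lra.
    by rewrite mulrDl mul1r lerD2l.
  by rewrite lerDl mulr_ge0// exprn_ge0// ?addr_ge0// invr_ge0 ltW.
apply: (@le_trans _ _ ((h^-1 + 1) ^+ m * b ^+ m)).
  rewrite -exprMn; apply: lerXn2r; rewrite ?nnegrE ?mulr_ge0 ?addr_ge0 ?invr_ge0 ?(ltW h0)//.
  by rewrite mulrDl mul1r lerD2r ler_pdivlMl// ltW.
by rewrite lerDr mulr_ge0 ?exprn_ge0// addr_ge0// ltW.
Qed.

End Arithmetic.

(** * Counting parallel integer vectors *)

Section Counting.
Context {n Q : nat}.
Notation vect := {ffun 'I_n -> 'I_Q}.

Lemma card_bounded_vect (k : nat) : (k <= Q)%N ->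
  #|[pred r : vect | [forall i, r i < k]%N]| = (k ^ n)%N.
Proof.
move=> kQ; rewrite (eq_card (B := ffun_on [pred c : 'I_Q | c < k]%N)).
  rewrite card_ffun_on card_ord; congr (_ ^ _)%N.
  rewrite -sum1_card -(big_ord_widen_cond _ xpredT (fun=> 1%N))//=.
  by rewrite sum1_card card_ord.
move=> r; apply/idP/ffun_onP => [|h]; rewrite inE.
  by move=> /forallP h i; rewrite inE.
by apply/forallP => i; have := h i; rewrite inE.
Qed.

(** The vectors meant are [(k, r)] and [(l, s)]. Only minors with the leading entries are tested;
    for [k > 0] their vanishing is proportionality. *)
Definition parallel (k : nat) (r : vect) (l : nat) (s : vect) := [forall i, (k * s i == l * r i)%N].

(* A vector [k :: r] with a parallel [l :: s] is divisible by [k %/ gcdn k l], and it determines [s]. *)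
Lemma card_parallel (k l : nat) : (0 < k)%N ->
  (#|[pred z : vect * vect | [forall i, z.1 i < k]%N && parallel k z.1 l z.2]| <= gcdn k l ^ n)%N.
Proof.
move=> k0; set D := [pred z | _].
pose g := gcdn k l.
have g0 : (0 < g)%N by rewrite gcdn_gt0 k0.
have gk : (g * (k %/ g) = k)%N by rewrite mulnC divnK// dvdn_gcdl.
have gl : (g * (l %/ g) = l)%N by rewrite mulnC divnK// dvdn_gcdr.
set e := (k %/ g)%N in gk; set e' := (l %/ g)%N in gl.
have e0 : (0 < e)%N by move: k0; rewrite -gk muln_gt0 => /andP[].
have cop : coprime e e'.
  by rewrite /coprime -(eqn_pmul2l g0) muln_gcdr gk gl muln1.
pose f (z : vect * vect) : {ffun 'I_n -> 'I_g.-1.+1} := [ffun i => inord (z.1 i %/ e)].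
have De z i : z \in D -> [/\ (e %| z.1 i)%N, (z.1 i %/ e < g)%N & (k * z.2 i = l * z.1 i)%N].
  rewrite inE => /andP[/forallP/(_ i) zk /forallP/(_ i)/eqP zp]; split=> //.
    have : (e * z.2 i = e' * z.1 i)%N.
      by apply/eqP; rewrite -(eqn_pmul2l g0) !mulnA gk gl zp.
    by move=> h; rewrite -(Gauss_dvdr _ cop) -h dvdn_mulr.
  by rewrite ltn_divLR// gk.
have f_inj : {in D &, injective f}.
  move=> z z' zD z'D /ffunP fz.
  have e1 i : z.1 i = z'.1 i.
    have [d1 b1 _] := De z i zD; have [d2 b2 _] := De z' i z'D.
    have := congr1 val (fz i); rewrite !ffunE /= !inordK ?prednK// => h.
    by apply: val_inj; rewrite /= -(divnK d1) h divnK.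
  have e2 i : z.2 i = z'.2 i.
    have [_ _ p1] := De z i zD; have [_ _ p2] := De z' i z'D.
    by apply/val_inj/eqP; rewrite /= -(eqn_pmul2l k0) p1 p2 e1.
  have E1 : z.1 = z'.1 by apply/ffunP.
  have E2 : z.2 = z'.2 by apply/ffunP.
  by rewrite (surjective_pairing z) (surjective_pairing z') E1 E2.
rewrite -(card_in_imset f_inj) (leq_trans (max_card _))//.
by rewrite card_ffun !card_ord prednK.
Qed.

End Counting.

(** * The second moment over finitely many levels *)

Section Divergence.
Context {R : realType} (n m : nat).
Hypothesis nm3 : (3 <= m + n)%N.
Notation I := ('I_n.+1 * 'I_m)%type.
Notation cube := (#|{: I}|.-tuple R).
Variables (P : probability cube R) (unifP : @uniform_cube R {: I} P) (y : 'rV[R]_m).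
Variable (delta : nat -> R).
Hypothesis delta0 : forall k, 0 <= delta k.
Hypothesis delta1 : forall k, delta k <= 1/2.

Definition qvec (k : nat) (r : 'I_n -> nat) (i : 'I_n.+1) : nat :=
  if unlift ord0 i is Some j then r j else k.

Lemma qvec0 k r : qvec k r ord0 = k.
Proof. by rewrite /qvec unlift_none. Qed.

Lemma qvec_lift k r j : qvec k r (lift ord0 j) = r j.
Proof. by rewrite /qvec liftK. Qed.

Section Level.
Variables (K0 Q : nat).
Notation vect := {ffun 'I_n -> 'I_Q}.
Notation idx := ('I_Q * vect)%type.

(** The entries below [u.1] leave the leading entry as the supremum norm. The cutoff [K0] forces
    large norms, as a limsup set requires, and [Q] keeps the family finite. *)
Definition in_level (u : idx) : bool := ((K0 <= u.1) && (0 < u.1))%N && [forall i, u.2 i < u.1]%N.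
Definition weight (k : nat) : R := (2 * delta k) ^+ m.
Definition level_set (u : idx) : set cube := approx_set y (delta u.1) (qvec u.1 (fun i => u.2 i)).
Definition level_mass : R := \sum_(k < Q | (K0 <= k)%N && (0 < k)%N) weight k * k%:R ^+ n.

Lemma weight_ge0 k : 0 <= weight k. Proof. by rewrite exprn_ge0// mulr_ge0. Qed.

Lemma sum_weight : \sum_(u | in_level u) weight u.1 = level_mass.
Proof.
rewrite -(pair_big_dep (fun k : 'I_Q => (K0 <= k)%N && (0 < k)%N)
  (fun (k : 'I_Q) (r : vect) => [forall i, r i < k]%N) (fun (k : 'I_Q) _ => weight k))/=.
apply: eq_bigr => k _; rewrite sumr_const card_bounded_vect ?(ltnW (ltn_ord k))//.
by rewrite -natrX mulr_natr.
Qed.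

(** The excess of the overlap of a parallel pair, charged to the vector with the larger leading
    entry. *)
Definition overlap_weight (u v : idx) : R := (parallel u.1 u.2 v.1 v.2 && (v.1 <= u.1)%N)%:R *
  (weight u.1 * ((gcdn u.1 v.1)%:R / (u.1)%:R) ^+ m).

Lemma overlap_weight_ge0 u v : 0 <= overlap_weight u v.
Proof. by rewrite mulr_ge0// mulr_ge0 ?weight_ge0// exprn_ge0// divr_ge0. Qed.

(** For given [k] and [l] there are at most [gcdn k l ^ n] parallel pairs, so level [k] contributes
    at most [weight k * k ^ n] times the sum of [(gcdn k l / k) ^ (m + n)]. There are [n.+1] rows
    here, and [nm3] makes the exponent at least 3. *)
Lemma sum_overlap_weight : \sum_(u | in_level u) \sum_(v | in_level v) overlap_weight u v <= 2 * level_mass.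
Proof.
pose a (k l : nat) : R := weight k * ((gcdn k l)%:R / k%:R) ^+ m.
have a0 k l : 0 <= a k l by rewrite mulr_ge0 ?weight_ge0// exprn_ge0// divr_ge0.
(* The constraints [K0 <= l] and [s i < l] are dropped, which puts the inner count in the form of
   [card_parallel]. *)
apply: (@le_trans _ _ (\sum_(k < Q | (K0 <= k)%N && (0 < k)%N)
   \sum_(r : vect | [forall i, r i < k]%N) \sum_(l < Q | (0 < l)%N && (l < k.+1)%N)
   \sum_(s : vect | parallel k r l s) a k l)).
  rewrite [leLHS](eq_bigl (fun u : idx => ((K0 <= u.1)%N && (0 < u.1)%N) &&
     [forall i, u.2 i < u.1]%N))//.
  rewrite -(pair_big_dep (fun k : 'I_Q => (K0 <= k)%N && (0 < k)%N)
    (fun (k : 'I_Q) (r : vect) => [forall i, r i < k]%N)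
    (fun (k : 'I_Q) r => \sum_(v | in_level v) overlap_weight (k, r) v))/=.
  apply: ler_sum => k _; apply: ler_sum => r _.
  rewrite (pair_big_dep (fun l : 'I_Q => (0 < l)%N && (l < k.+1)%N)
    (fun (l : 'I_Q) s => parallel k r l s) (fun (l : 'I_Q) _ => a k l))/=.
  rewrite big_mkcond [leRHS]big_mkcond/=; apply: ler_sum => v _.
  rewrite /overlap_weight /= ltnS; case: ifP => [|_]; last by case: ifP.
  move=> /andP[/andP[_ v0] _]; rewrite v0 /=.
  by rewrite andbC; case: ifP; rewrite ?mul1r ?mul0r.
rewrite /level_mass mulr_sumr; apply: ler_sum => k /andP[_ k0].
have kR : k%:R != 0 :> R by rewrite pnatr_eq0 -lt0n.
rewrite exchange_big/=.
apply: (@le_trans _ _ (\sum_(l < Q | (0 < l)%N && (l < k.+1)%N) a k l * (gcdn k l)%:R ^+ n)).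
  apply: ler_sum => l _.
  rewrite (pair_big_dep (fun r : vect => [forall i, r i < k]%N)
    (fun (r : vect) s => parallel k r l s) (fun _ _ => a k l))/=.
  rewrite sumr_const -[leLHS]mulr_natr ler_wpM2l// -natrX ler_nat.
  exact: card_parallel.
rewrite -(big_ord_widen_cond _ (fun l => 0 < l)%N (fun l => a k l * (gcdn k l)%:R ^+ n))//.
rewrite big_mkcond big_ord_recl/= add0r.
rewrite (eq_bigr (fun l : 'I_k => (weight k * k%:R ^+ n) * ((gcdn k l.+1)%:R / k%:R) ^+ (m + n))).
  rewrite -mulr_sumr mulrC ler_wpM2r ?mulr_ge0 ?weight_ge0 ?exprn_ge0//.
  exact: sum_gcd_ratio.
move=> l _; rewrite /a /bump /= add1n exprD -mulrA -[RHS]mulrA; congr (_ * _).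
rewrite mulrCA; congr (_ * _).
by rewrite -exprMn mulrC divfK.
Qed.

(** Pairs that are not parallel are independent. For parallel ones the overlap bound is applied with
    the larger leading entry first, and expanded by the inequality assumed on [C] with
    [a = 2 d * 2 d'] and [b = 2 d * g / k]. *)
Lemma prob_level_setI (eps C : R) u v : 0 < eps -> 0 <= C ->
  (forall a b : R, 0 <= a -> 0 <= b -> (a + b) ^+ m <= (1 + eps) * a ^+ m + C * b ^+ m) ->
  in_level u -> in_level v ->
  (P (level_set u `&` level_set v) <= ((1 + eps) * (weight u.1 * weight v.1) + C * (overlap_weight u v + overlap_weight v u))%:E)%E.
Proof.
move=> e0 C0 HC /andP[/andP[_ u0] _] /andP[/andP[_ v0] _].
have [par|] := boolP (parallel u.1 u.2 v.1 v.2); last first.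
  move=> /forallPn[j hj].
  have := @prob_approx_setI_indep R n m P unifP y (delta u.1) (delta v.1) (qvec u.1 (fun i => u.2 i))
    (qvec v.1 (fun i => v.2 i)) (lift ord0 j).
  rewrite !qvec0 !qvec_lift => /(_ u0 hj (delta0 _) (delta1 _) (delta0 _) (delta1 _)) h.
  apply: (le_trans h); rewrite lee_fin exprMn -/(weight u.1) -/(weight v.1).
  have w0 : 0 <= weight u.1 * weight v.1 by rewrite mulr_ge0 ?weight_ge0.
  have t0 : 0 <= C * (overlap_weight u v + overlap_weight v u) by rewrite mulr_ge0// addr_ge0 ?overlap_weight_ge0.
  by rewrite mulrDl mul1r -addrA lerDl addr_ge0// mulr_ge0// ltW.
have key (u' v' : idx) : (0 < u'.1)%N -> (v'.1 <= u'.1)%N -> parallel u'.1 u'.2 v'.1 v'.2 ->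
  (P (level_set u' `&` level_set v') <= ((1 + eps) * (weight u'.1 * weight v'.1) + C * overlap_weight u' v')%:E)%E.
  move=> u'0 vu p.
  have := @prob_approx_setI_overlap R n m P unifP y (delta u'.1) (delta v'.1) (qvec u'.1 (fun i => u'.2 i))
    (qvec v'.1 (fun i => v'.2 i)).
  rewrite !qvec0 => /(_ u'0 (delta0 _) (delta1 _) (delta0 _)) h.
  apply: (le_trans h); rewrite lee_fin mulrDr.
  apply: (le_trans (HC _ _ _ _)); rewrite ?mulr_ge0 ?invr_ge0//.
  by rewrite /overlap_weight p vu mul1r /weight -!exprMn.
have [vu|uv] := leqP v.1 u.1.
  apply: (le_trans (key u v u0 vu par)); rewrite lee_fin lerD2l ler_wpM2l// lerDl.
  exact: overlap_weight_ge0.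
have par' : parallel v.1 v.2 u.1 u.2.
  by apply/forallP => i; rewrite eq_sym; exact: (forallP par i).
rewrite setIC; apply: (le_trans (key v u v0 (ltnW uv) par')).
rewrite lee_fin [weight v.1 * _]mulrC lerD2l ler_wpM2l// lerDr.
exact: overlap_weight_ge0.
Qed.

(** This is [second_moment] with [E = (1 + eps) S ^ 2 + 4 C S], where [S] is the level mass: each of
    the two orders of a pair accounts for overlap weights of at most [2 S]. *)
Lemma prob_level_ge (eps C : R) : 0 < eps -> 0 <= C ->
  (forall a b : R, 0 <= a -> 0 <= b -> (a + b) ^+ m <= (1 + eps) * a ^+ m + C * b ^+ m) ->
  (((1 - eps) * level_mass ^+ 2 - 4 * C * level_mass)%:E <=
   (level_mass ^+ 2)%:E * P [set x | exists2 u, u \in enum in_level & level_set u x])%E.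
Proof.
move=> e0 C0 HC.
have enumE (F : idx -> R) : \sum_(u <- enum in_level) F u = \sum_(u | in_level u) F u.
  by rewrite big_enum.
have := @second_moment _ _ R P idx level_set (enum in_level) (fun u => weight u.1)
  ((1 + eps) * level_mass ^+ 2 + C * (4 * level_mass)).
rewrite enumE sum_weight.
rewrite (_ : 2 * _ - _ = (1 - eps) * level_mass ^+ 2 - 4 * C * level_mass); last by ring.
apply.
- by move=> u; exact: measurable_approx_set.
- by move=> u; exact: weight_ge0.
- move=> u; rewrite mem_enum => /andP[/andP[_ u0] _].
  by apply: prob_approx_set_ge; rewrite ?qvec0.
apply: (@le_trans _ _ (\sum_(u <- enum in_level) \sum_(v <- enum in_level)
   ((1 + eps) * (weight u.1 * weight v.1) + C * (overlap_weight u v + overlap_weight v u))%:E)%E).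
  rewrite big_seq [leRHS]big_seq; apply: lee_sum => u; rewrite mem_enum => lu.
  rewrite big_seq [leRHS]big_seq; apply: lee_sum => v; rewrite mem_enum => lv.
  exact: prob_level_setI.
under eq_bigr do rewrite sumEFin.
rewrite sumEFin lee_fin.
rewrite (eq_bigr (fun u : idx => (1 + eps) * weight u.1 * level_mass + C * (\sum_(v | in_level v) overlap_weight u v + \sum_(v | in_level v) overlap_weight v u))).
  rewrite enumE big_split/= -!mulr_suml -mulr_sumr sum_weight expr2 mulrA lerD2l.
  rewrite -mulr_sumr ler_wpM2l// big_split/= [X in _ + X]exchange_big/=.
  by apply: le_trans (lerD sum_overlap_weight sum_overlap_weight) _; lra.
move=> u _; rewrite big_split/= enumE -mulr_sumr -mulr_sumr sum_weight -mulr_sumr enumE big_split/=.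
by rewrite mulrA.
Qed.

End Level.

End Divergence.

(** * Covers by boxes, and the divergence case *)
Section OuterMeasure.
Context {R : realType} {n m : nat}.
Hypotheses (n0 : (0 < n)%N) (m0 : (0 < m)%N).
Notation M := 'M[R]_(n, m).

Lemma box_vol_ge0 (a b : M) : 0 <= box_vol a b.
Proof. by apply: prodr_ge0 => i _; apply: prodr_ge0 => j _; rewrite le_max lexx. Qed.

Lemma box_vol_point (a : M) : box_vol a a = 0.
Proof.
rewrite /box_vol (bigD1 (Ordinal n0))//= (bigD1 (Ordinal m0))//=.
by rewrite subrr maxxx !mul0r.
Qed.

Lemma lebesgue_outer_ge0 (A : set M) : (0 <= lebesgue_outer A)%E.
Proof.
apply: le_ereal_inf_tmp => _ [c _ <-]; apply: nneseries_ge0 => k _ _.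
by rewrite lee_fin box_vol_ge0.
Qed.

(** The lists are merged into one sequence of boxes along a bijection of [nat] with [nat * nat].
    Beyond the end of a list the default box is a point, of volume 0 because [n] and [m] are
    positive. *)
Lemma lebesgue_outer_le (A : set M) (L : nat -> seq (M * M)) :
  A `<=` \bigcup_k \bigcup_(b in [set` L k]) box b.1 b.2 ->
  (lebesgue_outer A <= \sum_(k <oo) (\sum_(b <- L k) box_vol b.1 b.2)%:E)%E.
Proof.
move=> AL.
have /card_set_bijP[h hbij] : ([set: nat] #= [set: nat * nat])%card.
  by rewrite card_eq_sym card_nat2.
pose g (z : nat * nat) : M * M := nth (0, 0) (L z.1) z.2.
apply: ge_ereal_inf; exists (\sum_(0 <= i <oo) (box_vol (g (h i)).1 (g (h i)).2)%:E)%E.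
  exists (g \o h) => // x /AL[k _ [b bL xb]].
  have [i _ hi] : (h @` setT) (k, index b (L k)).
    by have [_ _ /(_ (k, index b (L k)))] := hbij; apply.
  by exists i => //=; rewrite hi /g/= nth_index.
have v0 z : (0 <= (box_vol (g z).1 (g z).2)%:E)%E by rewrite lee_fin box_vol_ge0.
rewrite nneseries_esumT//.
rewrite -(@reindex_esum _ _ _ setT setT h (fun z => (box_vol (g z).1 (g z).2)%:E))//.
rewrite (_ : [set: nat * nat] = [set: nat] `*`` (fun=> [set: nat])); last first.
  by apply/seteqP; split.
rewrite -(@esum_esum _ _ _ setT (fun=> setT) (fun k l => (box_vol (g (k, l)).1 (g (k, l)).2)%:E))//; last first.
rewrite nneseries_esumT; last by move=> k; rewrite lee_fin; apply: sumr_ge0 => b _; exact: box_vol_ge0.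
apply: le_esum => k _.
rewrite -nneseries_esumT//.
rewrite (nneseries_split 0 (size (L k)))// eseries0 ?adde0; last first.
  by move=> l hl _; rewrite /g/= nth_default//= box_vol_point.
by rewrite add0n (big_nth (0, 0)) sumEFin.
Qed.

End OuterMeasure.

(** * Divergence of the series survives truncation at 1/2 *)

Section Unbounded.
Context {R : realType}.

(** Suppose the masses bounded. Each [k >= max K0 1] with [psi k >= 1/2] adds at least 1, so [psi]
    is eventually below 1/2. From there on truncation changes nothing, and the masses dominate the
    series, which would be finite. *)
Lemma level_mass_unbounded (n m : nat) (psi : nat -> R) (hpsi : forall q, 0 <= psi q) :
  @KG_series R n.+1 m psi = +oo%E -> forall K0 M,
  exists Q, M <= level_mass n m (fun k => Num.min (psi k) (1/2)) K0 Q.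
Proof.
move=> KGoo K0 M; apply: contrapT => /forallNP hM.
pose delta k := Num.min (psi k) (1/2).
have delta0 k : 0 <= delta k by rewrite le_min hpsi/=; lra.
pose s k := if (K0 <= k)%N && (0 < k)%N then (2 * delta k) ^+ m * k%:R ^+ n else 0.
have s0 k : 0 <= s k by rewrite /s; case: ifP => // _; rewrite mulr_ge0// exprn_ge0// mulr_ge0.
pose S Q := \sum_(k < Q) s k.
have SE Q : level_mass n m delta K0 Q = S Q by rewrite /level_mass big_mkcond.
have Slt Q : S Q < M by rewrite -SE ltNge; apply/negP; exact: hM.
have Smono Q Q' : (Q <= Q')%N -> S Q <= S Q'.
  by elim: Q' => [|Q' IH]; [rewrite leqn0 => /eqP ->|
    rewrite leq_eqVlt => /predU1P[->//|]; rewrite ltnS => /IH h;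
    rewrite /S big_ord_recr/= (le_trans h)// lerDl].
have [K1 hK1] : exists K1, forall k, (K1 <= k)%N -> psi k < 1/2.
  apply: contrapT => /forallNP hno.
  have big (N : nat) : exists Q, N%:R <= S Q.
    elim: N => [|N [Q hQ]]; first by exists 0%N; rewrite /S big_ord0.
    have /existsNP[k /not_implyP[hk /negP]] := hno (maxn Q (maxn K0 1)).
    rewrite -leNgt => hpk; move: hk; rewrite !geq_max => /and3P[h1 h2 h3].
    exists k.+1; rewrite -natr1 /S big_ord_recr/= lerD//.
      exact: le_trans hQ (Smono _ _ h1).
    rewrite /s h2 h3/= /delta min_r// (_ : 2 * (1 / 2) = 1 :> R); last by field.
    by rewrite expr1n mul1r exprn_ege1// ler1n.
  have [Q hQ] := big (Num.truncn M).+1.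
  by have := lt_le_trans (truncnS_gt M) hQ; rewrite ltNge (ltW (Slt Q)).
pose t q := q%:R ^+ n * psi q ^+ m.
have t0 q : 0 <= t q by rewrite mulr_ge0// exprn_ge0.
pose K2 := maxn K1 K0.
have ts q : (0 < q)%N -> t q <= (if (q < K2)%N then t q else 0) + s q.
  move=> q0; case: ltnP => hq; first by rewrite lerDl.
  move: hq; rewrite geq_max => /andP[h1 h0]; rewrite add0r /s h0 q0/=.
  rewrite /delta min_l; last by apply/ltW/hK1.
  rewrite /t [leLHS]mulrC ler_wpM2r ?exprn_ge0//.
  by apply: lerXn2r; rewrite ?nnegrE ?mulr_ge0//; have := hpsi q; lra.
have bnd N : \sum_(1 <= q < N) t q <= \sum_(q < K2) t q + M.
  apply: (@le_trans _ _ (\sum_(q < N) ((if (q < K2)%N then t q else 0) + s q))).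
    rewrite -(big_mkord xpredT (fun q => (if (q < K2)%N then t q else 0) + s q)).
    case: N => [|N]; first by rewrite !big_geq.
    rewrite [leRHS]big_ltn// ler_wpDl//.
      by rewrite addr_ge0//; case: ifP.
    by apply: ler_sum_nat => q /andP[q0 _]; exact: ts.
  rewrite big_split/= lerD//; last exact: ltW (Slt N).
  rewrite -big_mkcond/=; have [NK|KN] := leqP N K2.
    rewrite (big_ord_widen_cond K2 (fun q => q < K2)%N t)// big_mkcond/=.
    by apply: ler_sum => q _; case: ifP.
  by rewrite -(big_ord_widen N t (ltnW KN)).
have : (@KG_series R n.+1 m psi <= (\sum_(q < K2) t q + M)%:E)%E.
  rewrite /KG_series subn1/=; apply: lime_le.
    by apply: is_cvg_nneseries => q _ _; rewrite lee_fin; exact: t0.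
  by apply: nearW => N; rewrite sumEFin lee_fin bnd.
by rewrite KGoo leye_eq.
Qed.

End Unbounded.

(** * Full outer measure in the divergence case *)

Section Conclusion.
Context {R : realType} (n m : nat).
Hypotheses (m0 : (0 < m)%N) (nm3 : (3 <= m + n)%N).
Notation I := ('I_n.+1 * 'I_m)%type.
Notation cube := (#|{: I}|.-tuple R).
Variables (psi : nat -> R) (y : 'rV[R]_m).
Hypothesis hpsi : forall q, 0 <= psi q.
Let delta k := Num.min (psi k) (1/2).

Definition cube_matrix (x : cube) : 'M[R]_(n.+1, m) := \matrix_(i, j) crd x (i, j).

Let delta0 k : 0 <= delta k. Proof. by rewrite le_min hpsi/=; lra. Qed.
Let delta1 k : delta k <= 1/2. Proof. by rewrite ge_min lexx orbT. Qed.

Lemma level_set_good_pair (K0 Q : nat) (u : 'I_Q * {ffun 'I_n -> 'I_Q}) x :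
  in_level K0 u -> level_set y delta u x ->
  exists2 pq, good_pair psi y (cube_matrix x) pq & (K0 <= supnormZ pq.2)%N.
Proof.
move=> /andP[/andP[K0u u0] /forallP ur] ux.
have /choice[p hp] j := ux j.
pose q : 'rV[int]_n.+1 := \row_i (qvec u.1 (fun i => u.2 i) i)%:Z.
have qE : supnormZ q = u.1.
  apply/eqP; rewrite eqn_leq; apply/andP; split.
    apply/bigmax_leqP => i _; rewrite mxE absz_nat.
    case: (unliftP ord0 i) => [j ->|->]; rewrite ?qvec_lift ?qvec0//.
    exact: ltnW.
  by apply: leq_trans (leq_bigmax ord0); rewrite mxE absz_nat qvec0.
exists (\row_j p j, q); last by rewrite /= qE.
split=> /=.
  apply: contraTneq u0 => /rowP/(_ ord0); rewrite !mxE qvec0 => -[->].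
  by [].
move=> j; rewrite qE mxE (lt_le_trans _ (_ : delta u.1 <= _))//; last by rewrite ge_min lexx.
have := hp j; rewrite /lin !mxE addrAC; congr (`|_ + _ - _| < _).
by apply: eq_bigr => i _; rewrite !mxE.
Qed.

(** The limsup event [L] has probability 1 and its points are matrices of [A_set]. A cover of
    [A_set] by boxes therefore covers [L], and the volumes bound the probabilities of the boxes. *)
Lemma prob_limsup_box (P : probability cube R) (c : nat -> 'M[R]_(n.+1, m) * 'M[R]_(n.+1, m)) :
  uniform_cube P -> KG_series n.+1 m psi = +oo%E ->
  A_set psi y `<=` \bigcup_k box (c k).1 (c k).2 ->
  (1 <= \sum_(0 <= k <oo) (box_vol (c k).1 (c k).2)%:E)%E.
Proof.
move=> unifP KGoo Ac.
pose U K0 Q := [set x | exists2 u, u \in enum (in_level K0 (Q:=Q)) & @level_set R n m y delta Q u x].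
pose V K0 := \bigcup_Q U K0 Q.
(* Tuples have arbitrary real entries, so lying in the unit cube is one more almost sure event. *)
pose W := [set x : cube | forall i : I, (0 <= crd x i <= 1)%R].
have mU K0 Q : measurable (U K0 Q).
  by apply: measurable_exists_seq => u; exact: measurable_approx_set.
have mV K0 : measurable (V K0) by apply: bigcupT_measurable.
have mbox (a b : I -> R) : measurable [set x : cube | forall i : I, (a i <= crd x i <= b i)%R].
  rewrite (_ : [set x | _] = \bigcap_(i in [set` predT : {pred {: I}}]) [set x | (a i <= crd x i <= b i)%R]).
    apply: fin_bigcap_measurable => [|i _]; first exact: finite_finset.
    exact: measurable_crd_itv.
  by apply/seteqP; split => x; [move=> h k _|move=> h k]; exact: h.
have mW : measurable W by exact: mbox.
have PV K0 : (P (V K0) = 1)%E.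
  apply/eqP; rewrite eq_le probability_le1//=.
  apply/lee_addgt0Pr => e e0.
  have e2 : 0 < e / 2 by rewrite divr_gt0.
  have [C C0 HC] := exprD_le_eps m e2.
  (* A mass [S] of this size is positive and satisfies [4 C <= (e / 2) S], whence [(1 - e / 2) S ^ 2
     - 4 C S >= (1 - e) S ^ 2]. *)
  have [Q hQ] := level_mass_unbounded hpsi KGoo K0 (1 + 8 * C / e).
  set S := level_mass _ _ _ _ _ in hQ.
  have CE0 : 0 <= 8 * C / e by rewrite divr_ge0 ?mulr_ge0// ltW.
  have S0 : 0 < S by apply: lt_le_trans hQ; lra.
  have CS : 4 * C <= e / 2 * S.
    rewrite -ler_pdivrMl//; apply: le_trans (_ : 8 * C / e <= S); last by lra.
    by rewrite le_eqVlt; apply/orP; left; apply/eqP; field; rewrite gt_eqF.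
  have := prob_level_ge nm3 unifP y delta0 delta1 K0 Q e2 C0 HC.
  rewrite -/S -/(U K0 Q) => h.
  have UV : (P (U K0 Q) <= P (V K0))%E.
    by apply: le_measure; rewrite ?inE//; exact: bigcup_sup.
  have h2 : ((1 - e)%:E <= P (U K0 Q))%E.
    rewrite -(@lee_pmul2l _ (S ^+ 2)%:E) ?lte_fin ?exprn_gt0//.
    apply: le_trans h; rewrite -EFinM lee_fin expr2; nra.
  rewrite -leeBlDr// -EFinB; exact: le_trans h2 UV.
pose F k := if k is k'.+1 then ~` V k' else ~` W.
pose L := ~` (\bigcup_k F k).
have mF k : measurable (F k) by case: k => [|k]; exact: measurableC.
have mL : measurable L by apply: measurableC; exact: bigcupT_measurable.
have PF k : (P (F k) = 0)%E.
  by case: k => [|k]; rewrite probability_setC// ?PV ?(prob_unit_box unifP) subee.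
have PL : (P L = 1)%E.
  rewrite probability_setC; last exact: bigcupT_measurable.
  suff -> : (P (\bigcup_k F k) = 0)%E by rewrite sube0.
  apply/eqP; rewrite eq_le measure_ge0 andbT.
  apply: (le_trans (measure_sigma_subadditive P mF _ _)) => //.
    exact: bigcupT_measurable.
  by rewrite eseries0// => k _ _; exact: PF.
pose B k := [set x : cube | forall i : I, ((c k).1 i.1 i.2 <= crd x i <= (c k).2 i.1 i.2)%R].
have mB k : measurable (B k) by exact: (mbox (fun i => (c k).1 i.1 i.2) (fun i => (c k).2 i.1 i.2)).
have LB : L `<=` \bigcup_k B k.
  move=> x Lx.
  have Wx : W x by apply: contrapT => nW; apply: Lx; exists 0%N.
  have Vx K0 : V K0 x by apply: contrapT => nV; apply: Lx; exists K0.+1.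
  have /Ac[k _ kx] : A_set psi y (cube_matrix x).
    split; first by move=> i j; rewrite mxE; exact: Wx (i, j).
    move=> /finite_seqP[s hs].
    (* A level beyond every norm in the supposedly complete finite list gives a pair outside it. *)
    have [Q _ [u uE ux]] := Vx (\max_(pq <- s) supnormZ pq.2).+1.
    rewrite mem_enum in uE.
    have [pq gpq] := level_set_good_pair uE ux.
    rewrite ltnNge => /negP; apply.
    have pqs : pq \in s by have : [set` s] pq by rewrite -hs.
    exact: (leq_bigmax_seq _ pqs).
  by exists k => // -[i j]; have := kx i j; rewrite mxE.
rewrite -PL; apply: (le_trans (measure_sigma_subadditive P mB mL LB)).
apply: lee_nneseries => k _ //.
have := prob_box_le unifP (fun i : I => (c k).1 i.1 i.2) (fun i => (c k).2 i.1 i.2).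
by rewrite /box_vol pair_big.
Qed.

Lemma outer_A_set_le1 : (lebesgue_outer (@A_set R n.+1 m psi y) <= 1)%E.
Proof.
pose L (k : nat) : seq ('M[R]_(n.+1, m) * 'M[R]_(n.+1, m)) :=
  if k is 0%N then [:: (const_mx 0, const_mx 1)] else [::].
apply: (le_trans (@lebesgue_outer_le R n.+1 m isT m0 _ L _)).
  move=> x [hx _]; exists 0%N => //; exists (const_mx 0, const_mx 1); first by rewrite /= inE.
  by move=> i j /=; rewrite !mxE.
rewrite (nneseries_split 0 1); last by move=> k _; rewrite lee_fin; apply: sumr_ge0 => b _; exact: box_vol_ge0.
rewrite eseries0 ?adde0; last by move=> [|k]//= _ _; rewrite big_nil.
rewrite big_nat1 /= big_seq1 lee_fin /box_vol big1// => i _; rewrite big1// => j _.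
by rewrite !mxE subr0 max_r.
Qed.

Lemma outer_A_set_divergent : KG_series n.+1 m psi = +oo%E ->
  lebesgue_outer (@A_set R n.+1 m psi y) = 1%E.
Proof.
move=> KGoo; apply/eqP; rewrite eq_le outer_A_set_le1/=.
have [P unifP] := @exists_uniform_cube R {: I}.
by apply: le_ereal_inf_tmp => _ [c Ac <-]; exact: (prob_limsup_box unifP).
Qed.

End Conclusion.

(** * The convergence case *)
Section GridCover.
Context {R : realType} {n m : nat}.
Variables (q : 'I_n -> int) (i0 : 'I_n) (k : nat) (y : 'rV[R]_m) (d : R).
Hypotheses (qk : forall i, (`|q i| <= k)%N) (qi0 : `|q i0|%N = k) (k0 : (0 < k)%N) (d0 : 0 < d).
Variable N' : nat.
Let N := N'.+1.
(** The mesh [1 / N] is so fine that each linear form varies by at most [d] on a cell. *)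
Hypothesis kN : (n * k)%:R <= d * N%:R.

Let k_le : k%:R <= d * N%:R.
Proof.
apply: le_trans kN; rewrite ler_nat leq_pmull//.
by case: (n) i0 => // -[].
Qed.

Let NR : N%:R != 0 :> R. Proof. by rewrite pnatr_eq0. Qed.

Notation grid := ('M['I_N]_(n, m)).

Definition grid_lin (c : grid) (j : 'I_m) : R :=
  \sum_i (q i)%:~R * ((c i j : nat)%:R / N%:R) - y ord0 j.

(** The radius is doubled to absorb the passage from a point to the lower corner of its cell. *)
Definition grid_good (c : grid) : bool := [forall j, `[< nearZ (2 * d) (grid_lin c j) >]].

(** Addition in ['I_N] is modulo [N], so adding this matrix rotates row [i0] independently in each
    column. *)
Let shift (s : {ffun 'I_m -> 'I_N}) : grid := \matrix_(i, j) if i == i0 then s j else 0.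

(** A wrap-around modulo [N] changes the form by an integer multiple of [q i0], which [near_ind]
    does not see. *)
Let ind_shift c s j : near_ind (2 * d) (grid_lin (c + shift s) j) =
  near_ind (2 * d) ((q i0)%:~R * ((s j : nat)%:R / N%:R) + grid_lin c j).
Proof.
have [b hb] : exists b : nat, ((c i0 j : nat) + s j = ((c + shift s)%R i0 j : nat) + b * N)%N.
  exists ((c i0 j + s j) %/ N)%N; rewrite !mxE eqxx /=.
  by rewrite [RHS]addnC -divn_eq.
rewrite -[LHS](ind_intD _ _ (q i0 * b%:Z)); congr (near_ind _ _).
rewrite /grid_lin (bigD1 i0)//= [in RHS](bigD1 i0)//=.
have e : ((c + shift s)%R i0 j)%:R = (c i0 j)%:R + (s j)%:R - b%:R * N%:R :> R.
  by rewrite -natrD hb natrD natrM addrK.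
rewrite [((c + shift s)%R i0 j)%:R]e.
rewrite (eq_bigr (fun i => (q i)%:~R * ((c i j)%:R / N%:R))); last first.
  by move=> i ii0; rewrite !mxE (negbTE ii0) addr0.
rewrite intrM -pmulrn; field.
exact: NR.
Qed.

(** The constant is [4 + 1]: the progression bound with radius [2 d] gives [4 d N], and the gcd is
    at most [k <= d N]. A negative [q i0] is handled by reflection. *)
Let sum_ind_col w : \sum_(p < N) near_ind (2 * d) ((q i0)%:~R * (p%:R / N%:R) + w) <= 5 * d * N%:R.
Proof.
have prog v : \sum_(p < N) near_ind (2 * d) (k%:R * p%:R / N%:R + v) <= 5 * d * N%:R.
  have dd0 : 0 <= 2 * d by rewrite mulr_ge0// ltW.
  apply: (le_trans (sum_ind_progression k v (ltn0Sn N') dd0)).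
  have g : (gcdn N k)%:R <= k%:R :> R.
    by rewrite ler_nat dvdn_leq// dvdn_gcdr.
  by move: k_le g; rewrite -/N; lra.
have [qe|qe] : (q i0 = k%:Z) \/ (q i0 = - k%:Z) by lia.
  under eq_bigr do rewrite qe -pmulrn mulrA.
  exact: prog.
under eq_bigr do rewrite qe -indN opprD intrN -pmulrn mulNr opprK mulrA.
exact: prog.
Qed.

(* Average over the translations of row [i0] of [c] modulo [N], one for each column. *)
Lemma card_grid_good : #|grid_good|%:R <= N%:R ^+ (n * m) * (5 * d) ^+ m.
Proof.
pose f (c : grid) : R := \prod_j near_ind (2 * d) (grid_lin c j).
have -> : #|grid_good|%:R = \sum_c f c.
  rewrite -sum1_card natr_sum big_mkcond/=; apply: eq_bigr => c _.
  rewrite /f unfold_in /grid_good; case: forallP => [h|/forallP/forallPn[j hj]].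
    by rewrite big1// => j _; rewrite indE h.
  by rewrite (bigD1 j)//= indE (negbTE hj) mul0r.
have Nm0 : 0 < N%:R ^+ m :> R by rewrite exprn_gt0// ltr0n.
rewrite -(ler_pM2l Nm0).
have -> : N%:R ^+ m * \sum_c f c = \sum_c \sum_s f (c + shift s).
  rewrite exchange_big/= [RHS](eq_bigr (fun=> \sum_c f c)); last first.
    by move=> s _; rewrite [RHS](reindex_inj (addIr (shift s))).
  by rewrite sumr_const card_ffun !card_ord -[RHS]mulr_natl natrX.
apply: (@le_trans _ _ (\sum_(c : grid) (5 * d * N%:R) ^+ m)); last first.
  rewrite sumr_const card_mx card_ord -[leLHS]mulr_natl natrX exprMn.
  by rewrite le_eqVlt; apply/orP; left; apply/eqP; ring.
apply: ler_sum => c _.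
rewrite (eq_bigr (fun s : {ffun 'I_m -> 'I_N} => \prod_j near_ind (2 * d) ((q i0)%:~R * ((s j)%:R / N%:R) + grid_lin c j))); last first.
  by move=> s _; apply: eq_bigr => j _; exact: ind_shift.
(* Each column has its own shift, so the sum over all shifts is a product of sums over single
   columns. *)
rewrite -(bigA_distr_bigA (fun j (p : 'I_N) => near_ind (2 * d) ((q i0)%:~R * (p%:R / N%:R) + grid_lin c j))).
rewrite -[X in _ ^+ X]card_ord -prodr_const; apply: ler_prod => j _.
by rewrite sum_ind_col andbT; apply: sumr_ge0 => p _; exact: ind_ge0.
Qed.

Definition cell (c : grid) : 'M[R]_(n, m) * 'M[R]_(n, m) :=
  (\matrix_(i, j) ((c i j : nat)%:R / N%:R), \matrix_(i, j) ((c i j).+1%:R / N%:R)).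

Lemma cell_vol c : box_vol (cell c).1 (cell c).2 = N%:R ^- (n * m).
Proof.
rewrite /box_vol /cell/= (eq_bigr (fun=> \prod_(j < m) N%:R^-1)); last first.
  move=> i _; apply: eq_bigr => j _; rewrite !mxE -mulrBl -natrB// subSnn mul1r.
  by rewrite max_r// invr_ge0.
by rewrite !prodr_const !card_ord -exprM mulnC exprVn.
Qed.

Lemma grid_cover (x : 'M[R]_(n, m)) : (forall i j, 0 <= x i j <= 1) ->
  (forall j, nearZ d (\sum_i (q i)%:~R * x i j - y ord0 j)) ->
  exists2 c, c \in enum grid_good & box (cell c).1 (cell c).2 x.
Proof.
move=> x01 xn.
have N0 : 0 < N%:R :> R by rewrite ltr0n.
(* The cap [N'] puts an entry equal to 1 into the last cell. *)
have [c cE] : exists c : grid, forall i j, (c i j : nat) = minn (Num.truncn (x i j * N%:R)) N'.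
  exists (\matrix_(i, j) inord (minn (Num.truncn (x i j * N%:R)) N')) => i j.
  by rewrite mxE inordK// ltnS geq_minr.
have cx i j : (c i j)%:R / N%:R <= x i j <= (c i j).+1%:R / N%:R.
  have /andP[x0 x1] := x01 i j.
  have xN : 0 <= x i j * N%:R by rewrite mulr_ge0.
  rewrite ler_pdivrMr// ler_pdivlMr// cE; apply/andP; split.
    apply: (@le_trans _ _ (Num.truncn (x i j * N%:R))%:R); first by rewrite ler_nat geq_minl.
    by rewrite truncn_le.
  case: leqP => _; first exact: ltW (truncnS_gt _).
  by rewrite -[leRHS]mul1r ler_pM2r.
exists c; last by move=> i j; rewrite !mxE; exact: cx.
rewrite mem_enum; apply/forallP => j; apply/asboolP; have [p hp] := xn j; exists p.
have e : grid_lin c j + p%:~R = (\sum_i (q i)%:~R * x i j - y ord0 j + p%:~R) +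
    \sum_i (q i)%:~R * ((c i j)%:R / N%:R - x i j).
  have -> : \sum_i (q i)%:~R * ((c i j)%:R / N%:R - x i j) =
      \sum_i (q i)%:~R * ((c i j)%:R / N%:R) - \sum_i (q i)%:~R * x i j.
    by rewrite -sumrB; apply: eq_bigr => i _; rewrite mulrBr.
  by rewrite /grid_lin; ring.
rewrite e (le_lt_trans (ler_normD _ _))// mulr_natl mulr2n ltr_leD//.
apply: (le_trans (ler_norm_sum _ _ _)).
apply: (@le_trans _ _ (\sum_(i < n) k%:R / N%:R)); last first.
  rewrite sumr_const card_ord -[leLHS]mulr_natl mulrA -natrM ler_pdivrMr//.
apply: ler_sum => i _; rewrite normrM ler_pM//.
  by rewrite -intr_norm -abszE -pmulrn ler_nat.
have /andP[h1 h2] := cx i j; rewrite ler_norml; apply/andP; split.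
  by move: h2; rewrite -natr1 mulrDl mul1r; lra.
by rewrite (@le_trans _ _ 0)// ?subr_le0// invr_ge0.
Qed.

End GridCover.

(** * Covers of whole spheres of integer vectors, and vanishing tails *)

Section Convergence.
Context {R : realType} (n m : nat).
Hypotheses (m0 : (0 < m)%N).
Variables (psi : nat -> R) (y : 'rV[R]_m).
Hypothesis hpsi : forall q, 0 <= psi q.
Notation M := 'M[R]_(n.+1, m).

Lemma cover_vector (q : 'I_n.+1 -> int) (i0 : 'I_n.+1) (k : nat) :
  (forall i, (`|q i| <= k)%N) -> `|q i0|%N = k -> (0 < k)%N ->
  exists L : seq (M * M), \sum_(b <- L) box_vol b.1 b.2 <= (5 * psi k) ^+ m /\
   forall x : M, (forall i j, 0 <= x i j <= 1) ->
     (forall j, nearZ (psi k) (\sum_i (q i)%:~R * x i j - y ord0 j)) ->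
     exists2 b, b \in L & box b.1 b.2 x.
Proof.
(* If [psi k = 0], the strict inequality fails in the first column and the empty list is a cover. *)
move=> qk qi0 k0; have := hpsi k; rewrite le_eqVlt => /predU1P[p0|p0].
  exists [::]; split; first by rewrite big_nil exprn_ge0// mulr_ge0.
  move=> x _ /(_ (Ordinal m0))[p]; rewrite -p0 => h.
  by have := le_lt_trans (normr_ge0 _) h; rewrite ltxx.
pose N' := Num.truncn ((n.+1 * k)%:R / psi k).
have kN : (n.+1 * k)%:R <= psi k * N'.+1%:R.
  by rewrite mulrC -ler_pdivrMr// ltW// truncnS_gt.
exists [seq cell c | c <- enum (@grid_good R n.+1 m q y (psi k) N')]; split; last first.
  move=> x x01 xn; have [c cg xc] := grid_cover qk kN x01 xn.
  by exists (cell c) => //; exact: map_f.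
rewrite big_map (eq_bigr (fun=> N'.+1%:R ^- (n.+1 * m))); last by move=> c _; exact: cell_vol.
rewrite big_const_seq count_predT iter_addr_0 -cardE -[leLHS]mulr_natr mulrC ler_pdivrMr ?exprn_gt0 ?ltr0n//.
rewrite [leRHS]mulrC; have := card_grid_good y qi0 k0 p0 kN; exact.
Qed.

(** Parametrizes, with repetitions, the integer vectors of supremum norm [k]: the position of an
    extremal entry, its sign, and the other entries raised by [k]. *)
Definition sphere_vec (k : nat) (z : 'I_n.+1 * bool * {ffun 'I_n -> 'I_(2 * k).+1}) (i : 'I_n.+1) : int :=
  if unlift z.1.1 i is Some j then (z.2 j)%:Z - k%:Z else if z.1.2 then k%:Z else - k%:Z.

Lemma sphere_vec_le k z i : (`|@sphere_vec k z i| <= k)%N.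
Proof.
rewrite /sphere_vec; case: unliftP => [j _|_]; last by case: z.1.2; lia.
by have := ltn_ord (z.2 j); lia.
Qed.

Lemma sphere_vec_max k z : `|@sphere_vec k z z.1.1|%N = k.
Proof. by rewrite /sphere_vec unlift_none; case: z.1.2; lia. Qed.

Lemma sphere_vecP (q : 'rV[int]_n.+1) : exists z, forall i, q ord0 i = @sphere_vec (supnormZ q) z i.
Proof.
have [i0 hi0] : exists i0, supnormZ q = `|q ord0 i0|%N.
  by have [|i0 h] := @bigop.eq_bigmax _ (fun i => `|q ord0 i|%N) _; [rewrite card_ord|exists i0].
have qle i : (`|q ord0 i| <= supnormZ q)%N by exact: leq_bigmax.
set k := supnormZ q in hi0 qle *.
exists (i0, (0 <= q ord0 i0), [ffun j => inord (absz (q ord0 (lift i0 j) + k%:Z))]) => i.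
rewrite /sphere_vec /=; case: unliftP => [j ->|->]; last by case: ifP => h; lia.
have h := qle (lift i0 j); rewrite ffunE inordK; lia.
Qed.

(** The covers of single vectors are joined over all [2 (n + 1) (2 k + 1) ^ n] parameters of the
    sphere. *)
Lemma cover_sphere (k : nat) : (0 < k)%N -> exists L : seq (M * M),
  \sum_(b <- L) box_vol b.1 b.2 <= (n.+1 * 2)%:R * (2 * k).+1%:R ^+ n * (5 * psi k) ^+ m /\
  forall (x : M) (pq : 'rV[int]_m * 'rV[int]_n.+1), (forall i j, 0 <= x i j <= 1) ->
    good_pair psi y x pq -> supnormZ pq.2 = k -> exists2 b, b \in L & box b.1 b.2 x.
Proof.
move=> k0; pose Z := ('I_n.+1 * bool * {ffun 'I_n -> 'I_(2 * k).+1})%type.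
have /choice[L HL] (z : Z) := cover_vector (sphere_vec_le z) (sphere_vec_max z) k0.
exists (flatten [seq L z | z <- enum {: Z}]); split.
  rewrite big_flatten/= big_map.
  apply: (@le_trans _ _ (\sum_(z <- enum {: Z}) (5 * psi k) ^+ m)).
    by apply: ler_sum => z _; case: (HL z).
  rewrite big_const_seq count_predT iter_addr_0 -cardE -[leLHS]mulr_natl.
  by rewrite !card_prod card_bool card_ffun !card_ord natrM natrX.
move=> x [p q] x01 [/= q0 gq] qk; have [z hz] := sphere_vecP q.
move: z hz; rewrite qk => z hz.
have [_ /(_ x x01)] := HL z; case.
  move=> j; exists (p ord0 j); have := gq j; rewrite qk mxE addrAC.
  by congr (`|_ - _ + _| < _); apply: eq_bigr => i _; rewrite mxE hz.
move=> b bL xb; exists b => //; apply/flattenP; exists (L z) => //.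
by apply: map_f; rewrite mem_enum.
Qed.

(** Since [x] lies in the unit cube, a bound on [q] also bounds [p], which leaves finitely many
    pairs. *)
Lemma good_pair_unbounded (x : M) (K : nat) : (forall i j, 0 <= x i j <= 1) ->
  ~ finite_set (good_pair psi y x) ->
  exists2 pq, good_pair psi y x pq & (K <= supnormZ pq.2)%N.
Proof.
move=> x01 inf; apply: contrapT => /forall2NP hno; apply: inf.
(* By the triangle inequality [X] bounds every entry of [p]; the sums stand in for maxima of [psi]
   and of the entries of [y]. *)
pose X := \sum_(k < K) psi k + \sum_j `|y ord0 j| + (n.+1 * K)%:R.
pose B := (Num.truncn X).+1.
pose G (z : {ffun 'I_m -> 'I_(2 * B).+1} * {ffun 'I_n.+1 -> 'I_(2 * K).+1}) :
    'rV[int]_m * 'rV[int]_n.+1 :=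
  (\row_j ((z.1 j)%:Z - B%:Z), \row_i ((z.2 i)%:Z - K%:Z)).
apply: (@sub_finite_set _ _ (G @` setT)); last first.
  by apply: finite_image; exact: finite_finset.
move=> [p q] /= gpq.
have qK : (supnormZ q < K)%N.
  by have [//|/negP] := hno (p, q); rewrite -ltnNge.
have qle i : (`|q ord0 i| <= K)%N.
  by apply: leq_trans (ltnW qK); exact: leq_bigmax.
have pB j : (`|p ord0 j| <= B)%N.
  have [_ /(_ j)] := gpq; rewrite /= mxE => h.
  rewrite -(ler_nat R); apply: le_trans (ltW (truncnS_gt X)).
  have -> : `|p ord0 j|%:R = `| (p ord0 j)%:~R | :> R.
    by rewrite -intr_norm -abszE -pmulrn.
  have h1 : psi (supnormZ q) <= \sum_(k < K) psi k.
    by rewrite (bigD1 (Ordinal qK))//= lerDl; apply: sumr_ge0.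
  have h2 : `|y ord0 j| <= \sum_j `|y ord0 j|.
    by rewrite (bigD1 j)//= lerDl; apply: sumr_ge0.
  have h3 : `|\sum_i (map_mx intr q) ord0 i * x i j| <= (n.+1 * K)%:R.
    apply: (le_trans (ler_norm_sum _ _ _)).
    apply: (@le_trans _ _ (\sum_(i < n.+1) K%:R)); last first.
      by rewrite sumr_const card_ord -[leLHS]mulr_natl natrM.
    apply: ler_sum => i _; rewrite normrM mxE -[leRHS]mulr1 ler_pM//.
      by rewrite -intr_norm -abszE -pmulrn ler_nat.
    by have /andP[x0 x1] := x01 i j; rewrite ger0_norm.
  move: h h1 h2 h3; rewrite /X.
  set s := \sum_i _ * _; set Y := y ord0 j; set P := (p ord0 j)%:~R => h h1 h2 h3.
  have -> : P = (s + P - Y) + (Y - s) by ring.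
  apply: (le_trans (ler_normD _ _)); have := ler_normB Y s; lra.
exists ([ffun j => inord (absz (p 0 j + B%:Z))], [ffun i => inord (absz (q 0 i + K%:Z))]) => //.
rewrite /G /=; congr pair; apply/rowP => i; rewrite !mxE ffunE inordK.
- by have : (`|p 0%R i| <= B)%N := pB i; lia.
- by have : (`|p 0%R i| <= B)%N := pB i; lia.
- by have : (`|q 0%R i| <= K)%N := qle i; lia.
- by have : (`|q 0%R i| <= K)%N := qle i; lia.
Qed.

(** For every [K] the covers of the spheres of radius at least [K] cover [A_set], and their total
    volume is at most a constant times a tail of the series. *)
Lemma outer_A_set_convergent : (KG_series n.+1 m psi < +oo)%E ->
  lebesgue_outer (@A_set R n.+1 m psi y) = 0%E.
Proof.
move=> KGoo.
have /choice[L HL] k := cover_sphere (ltn0Sn k).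
(* The power of 3 comes from [2 k + 1 <= 3 k] for [k >= 1]. *)
pose C : R := (n.+1 * 2)%:R * 3 ^+ n * 5 ^+ m.
have C0 : 0 <= C by rewrite !mulr_ge0// exprn_ge0.
pose t k : R := k%:R ^+ n * psi k ^+ m.
have t0 k : (0 <= (t k)%:E)%E by rewrite lee_fin mulr_ge0// exprn_ge0.
have tail K : (lebesgue_outer (@A_set R n.+1 m psi y) <= C%:E * \sum_(K <= k <oo) (t k)%:E)%E.
  (* The list [L k] covers the sphere of radius [k + 1], hence the predecessor. *)
  pose L' k := if (K <= k)%N && (0 < k)%N then L k.-1 else [::].
  have s0 k : (0 <= (\sum_(b <- L' k) box_vol b.1 b.2)%:E)%E.
    by rewrite lee_fin; apply: sumr_ge0 => b _; exact: box_vol_ge0.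
  apply: (le_trans (@lebesgue_outer_le R n.+1 m isT m0 _ L' _)).
    move=> x [x01 /(@good_pair_unbounded x K x01)[pq gpq Kpq]].
    have k0 : (0 < supnormZ pq.2)%N.
      rewrite lt0n; apply/negP => /eqP q0; have [/negP + _] := gpq; apply.
      apply/eqP/rowP => i; rewrite mxE; apply/eqP; rewrite -absz_eq0 -leqn0.
      by apply: (@leq_trans (supnormZ pq.2)); [exact: leq_bigmax|rewrite q0].
    have [_ /(_ x pq x01 gpq)] := HL (supnormZ pq.2).-1; rewrite prednK// => /(_ erefl)[b bL xb].
    by exists (supnormZ pq.2) => //; exists b => //=; rewrite /L' Kpq k0.
  rewrite (nneseries_split 0 K)// add0n big_nat big1 ?add0e; last first.
    by move=> k /andP[_ kK]; rewrite /L' leqNgt kK/= big_nil.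
  rewrite -nneseriesZl//; apply: lee_nneseries => // k _.
  rewrite -EFinM lee_fin /L'; case: ifP => [/andP[_ k0]|_]; last first.
    by rewrite big_nil mulr_ge0// -lee_fin.
  have [h _] := HL k.-1; apply: (le_trans h); rewrite prednK//.
  rewrite /C /t exprMn -!mulrA ler_wpM2l// mulrCA [leRHS]mulrCA ler_wpM2l ?exprn_ge0//.
  rewrite mulrA ler_wpM2r ?exprn_ge0// -exprMn.
  by apply: lerXn2r; rewrite ?nnegrE ?mulr_ge0// -natrM ler_nat; lia.
have cv : (\sum_(K <= k <oo) (t k)%:E)%E @[K --> \oo] --> 0%E.
  apply: nneseries_tail_cvg => //.
  rewrite (nneseries_split 0 1)// big_nat1 lte_add_pinfty ?ltry//.
  by move: KGoo; rewrite /KG_series subn1.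
apply/eqP; rewrite eq_le lebesgue_outer_ge0 andbT.
have cv2 : (C%:E * \sum_(K <= k <oo) (t k)%:E)%E @[K --> \oo] --> 0%E.
  by have := cvgeZl (isT : C%:E \is a fin_num) cv; rewrite mule0.
rewrite -(cvg_lim _ cv2)//; apply: lime_ge; first by apply/cvg_ex; exists 0%E.
exact: nearW.
Qed.

End Convergence.

Theorem theorem1 (R : realType) (n m : nat) (hn : (1 <= n)%N) (hm : (1 <= m)%N)
  (hnm : (2 < n * m)%N) (psi : nat -> R) (hpsi : forall q, 0 <= psi q)
  (y : 'rV[R]_m) :
  ((@KG_series R n m psi < +oo)%E -> @lebesgue_outer R n m (@A_set R n m psi y) = 0%E) /\
  (@KG_series R n m psi = +oo%E -> @lebesgue_outer R n m (@A_set R n m psi y) = 1%E).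
Proof.
case: n hn hnm => [//|n'] _ hnm; split; first exact: outer_A_set_convergent.
apply: outer_A_set_divergent => //.
(* If [m + n' <= 2] with [m >= 1], then [n'.+1 * m] is at most 2. *)
by rewrite leqNgt; apply/negP => h; move: hnm hm; nia.
Qed.
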